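(* Let $d\in \mathbb{N}$, $n\in\mathbb{N}_0$ and $\mathbf{s}=(s_1,\dots,s_d)\in\mathbb{N}^d$. Let $y\in(-\pi/2,\pi/2)$ if $s_1=1$ and $y\in[-\pi/2,\pi/2]$ if $s_1\ge 2$. For each $j=1,\dots,d$ let $l_j$ be one of the functions $m\mapsto 2m$, $m\mapsto 2m+1$, $m\mapsto 2m-1$, and let the relation $\succ_j$ be ''$\ge$'' if $l_j(m)=2m+1$ and ''$>$'' otherwise. Then \[ \sum_{n_1 \succ_1 n_2\succ_2 \cdots\succ_{d-1} n_d\succ_d n} \frac{b_{n_1}(\sin y)}{ l_1(n_1)^{s_1}\cdots l_d(n_d)^{s_d}} = \frac{d}{dy} \int_0^y \lambda_{l_1,s_1} \circ \cdots\circ \lambda_{l_d,s_d} \circ b_{n}(\sin t)\,dt, \] where $\lambda_{l,s}=g_s$ if $l(m)=2m$, $\lambda_{l,s}=h_s$ if $l(m)=2m+1$, $\lambda_{l,s}=\kappa_s$ if $l(m)=2m-1$. Moreover, for all $x\in(-1,1)$, \[ \sum_{n_1 \succ_1 \cdots\succ_{d-1} n_d\succ_d n} \frac{b_{n_1}(x)}{ l_1(n_1)^{s_1}\cdots l_d(n_d)^{s_d}} = \sqrt{1-x^2}\, \frac{d}{dx} \int_0^x \Lambda_{l_1,s_1} \circ \cdots\circ \Lambda_{l_d,s_d} \circ b_{n}(t)\, \omega_1, \] where $\Lambda_{l,s}=G_s$, $H_s$, $K_s$ according as $l(m)=2m$, $2m+1$, $2m-1$.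
   Context: $b_n(x)=4^n\binom{2n}{n}^{-1}x^{2n}$ for $n\in\mathbb{N}_0$ ($\binom00=1$). Iterated integrals: $\int_0^y f_1(t)dt\circ\cdots\circ f_p(t)dt:=\int_{y>t_1>\cdots>t_p>0} f_1(t_1)\cdots f_p(t_p)\,dt_1\cdots dt_p$, extended multilinearly to formal sums; $(\alpha)^k=\alpha\circ\cdots\circ\alpha$. Extended notation: a factor $(f(t)dt+F(t))$ followed by a 1-form $g(t)dt$ stands for $f(t)dt\circ g(t)dt$ plus $(F(t)g(t))dt$; so $(f\,dt+1)$ contributes the word with $f\,dt$ plus the word with that factor omitted. Trigonometric forms: $g_1=\tan t\,dt$, $g_s=dt\circ(\cot t\,dt)^{s-2}\circ dt$ ($s\ge2$); $h_1=2\csc 2t\,dt$, $h_s=\csc t\,dt\circ(\cot t\,dt)^{s-2}\circ\csc t\,dt$ ($s\ge2$); $\kappa_1=\sin t\,dt\circ\csc t\,dt+\tan t\,dt$, $\kappa_s=\sin t\,dt\circ(\cot t\,dt+1)\circ(\cot t\,dt)^{s-2}\circ\csc t\,dt$ ($s\ge2$). Non-trigonometric forms: $\omega_0=\frac{dt}{t}$, $\omega_1=\frac{dt}{\sqrt{1-t^2}}$, $\omega_2=\frac{t\,dt}{1-t^2}$, $\omega_3=\frac{dt}{t\sqrt{1-t^2}}$, $\omega_5=\frac{t\,dt}{\sqrt{1-t^2}}$; $G_1=\omega_2$, $G_s=\omega_1\circ\omega_0^{s-2}\circ\omega_1$ ($s\ge2$); $H_1=\omega_0+\omega_2$, $H_s=\omega_3\circ\omega_0^{s-2}\circ\omega_3$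 ($s\ge2$); $K_1=\omega_5\circ\omega_3+\omega_2$, $K_s=\omega_5\circ(\omega_0+1)\circ\omega_0^{s-2}\circ\omega_3$ ($s\ge2$). *)

(* Defs.v *)
From HB Require Import structures.
From mathcomp Require Import all_boot all_order all_algebra.
From mathcomp Require Import all_classical all_reals all_analysis.

Set Implicit Arguments.
Unset Strict Implicit.
Unset Printing Implicit Defensive.
Import Order.TTheory GRing.Theory Num.Theory.
Import numFieldNormedType.Exports.

Local Open Scope classical_set_scope.
Local Open Scope ring_scope.

Definition bfun (R : realType) (n : nat) (x : R) : R :=
  4 ^+ n * ('C(2 * n, n)%:R)^-1 * x ^+ (2 * n).

(* The three admissible functions: m |-> 2m, m |-> 2m+1, m |-> 2m-1. *)
Inductive lfun := L2m | L2mp1 | L2mm1.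

(* Real-valued, so that 2m-1 is not truncated. *)
Definition lval (R : realType) (l : lfun) (m : nat) : R :=
  match l with
  | L2m => 2 * m%:R
  | L2mp1 => 2 * m%:R + 1
  | L2mm1 => 2 * m%:R - 1
  end.

Definition lsucc (l : lfun) (m m' : nat) : bool :=
  match l with
  | L2mp1 => (m' <= m)%N
  | _ => (m' < m)%N
  end.

(* Indices are 0-based: tnth ns j is n_(j+1).  The default value of nth makes
   the entry following the last one equal to n. *)
Definition chains (d : nat) (l : d.-tuple lfun) (n : nat) :
    set (d.-tuple nat) :=
  [set ns | forall j : 'I_d, lsucc (tnth l j) (tnth ns j) (nth n ns j.+1)].

(* Every term is nonnegative: the powers of x are even, and along a chain 2m
   and 2m-1 are only evaluated at m >= 1.  Hence the supremum of finite partial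
   sums computed by \esum is the sum of the multiple series. *)
Definition nested_sum (R : realType) (d : nat) (l : d.-tuple lfun)
    (s : d.-tuple nat) (n : nat) (x : R) : \bar R :=
  \esum_(ns in chains l n)
     (bfun (head 0%N ns) x
        / \prod_(j < d) lval R (tnth l j) (tnth ns j) ^+ tnth s j)%:E.

Section IteratedIntegrals.
Context {R : realType}.
Implicit Types (f : R -> R) (y : R).

(* The 1-form f(t)dt is represented by f. *)
Definition word := seq (R -> R).

Definition segment0 y : set R := `]Num.min 0 y, Num.max 0 y[.

Definition integral_from0 f y : R :=
  Num.sg y * \int[lebesgue_measure]_(t in segment0 y) f t.

(* For y < 0 the inequalities y > t_1 > ... > t_p > 0 are reversed and every
   integration is oriented from 0 to y. *)
Fixpoint iterint_word (w : word) y : R :=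
  if w is f :: w' then integral_from0 (fun t => f t * iterint_word w' t) y else 1.

(* The integrals in iterint_word converge absolutely.  The inner ones are only
   required at interior points: t tan t is not integrable up to pi/2, yet its
   primitive is. *)
Fixpoint convergent_word (w : word) y : Prop :=
  if w is f :: w' then
    lebesgue_measure.-integrable (segment0 y)
      (fun t => (f t * iterint_word w' t)%:E)
    /\ (forall t, segment0 y t -> convergent_word w' t)
  else True.

(* Formal sums of words; the empty word [::] is the unit of composition, so
   f dt + 1 is the formal sum of the words f dt and [::]. *)
Definition fsum := seq word.

Definition form f : fsum := [:: [:: f]].
Definition fone : fsum := [:: [::]].
Definition fadd (P Q : fsum) : fsum := P ++ Q.
Definition fcomp (P Q : fsum) : fsum := [seq u ++ w | u <- P, w <- Q].
Definition fpow (P : fsum) (k : nat) : fsum := iter k (fcomp P) fone.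

Definition iterint (P : fsum) y : R := \sum_(w <- P) iterint_word w y.

Definition convergent (P : fsum) y : Prop :=
  foldr (fun w => and (convergent_word w y)) True P.

(* Derivative at y of a function on D; it is one-sided at an end point of D. *)
Definition has_derivative_on (D : set R) f y (v : R) : Prop :=
  (f z - f y) / (z - y) @[z --> within (D `\ y) (nbhs y)] --> v.

End IteratedIntegrals.

Arguments word : clear implicits.
Arguments fsum : clear implicits.

Declare Scope form_scope.
Delimit Scope form_scope with form.
Bind Scope form_scope with fsum.
Notation "P ** Q" := (fcomp P Q)
  (at level 40, left associativity) : form_scope.
Notation "P + Q" := (fadd P Q) : form_scope.
Notation "P ^ k" := (fpow P k) : form_scope.
Notation "1" := fone : form_scope.

Section Forms.
Context {R : realType}.

Definition cot (t : R) : R := cos t / sin t.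
Definition csc (t : R) : R := (sin t)^-1.

Definition dt : fsum R := form (fun=> 1).
Definition sin_dt : fsum R := form (@sin R).
Definition tan_dt : fsum R := form (@tan R).
Definition cot_dt : fsum R := form cot.
Definition csc_dt : fsum R := form csc.

(* In the six families below the exponent s = 0 is never used. *)
Definition g_form (s : nat) : fsum R :=
  if s is k.+2 then (dt ** cot_dt ^ k ** dt)%form else tan_dt.

Definition h_form (s : nat) : fsum R :=
  if s is k.+2 then (csc_dt ** cot_dt ^ k ** csc_dt)%form
  else form (fun t => 2 * csc (2 * t)).

Definition kappa_form (s : nat) : fsum R :=
  if s is k.+2 then (sin_dt ** (cot_dt + 1) ** cot_dt ^ k ** csc_dt)%form
  else (sin_dt ** csc_dt + tan_dt)%form.

Definition omega0 (t : R) : R := t^-1.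
Definition omega1 (t : R) : R := (Num.sqrt (1 - t ^+ 2))^-1.
Definition omega2 (t : R) : R := t / (1 - t ^+ 2).
Definition omega3 (t : R) : R := (t * Num.sqrt (1 - t ^+ 2))^-1.
Definition omega5 (t : R) : R := t / Num.sqrt (1 - t ^+ 2).

Definition G_form (s : nat) : fsum R :=
  if s is k.+2 then (form omega1 ** form omega0 ^ k ** form omega1)%form
  else form omega2.

Definition H_form (s : nat) : fsum R :=
  if s is k.+2 then (form omega3 ** form omega0 ^ k ** form omega3)%form
  else (form omega0 + form omega2)%form.

Definition K_form (s : nat) : fsum R :=
  if s is k.+2 then
    (form omega5 ** (form omega0 + 1) ** form omega0 ^ k ** form omega3)%form
  else (form omega5 ** form omega3 + form omega2)%form.

Definition lambda (l : lfun) (s : nat) : fsum R :=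
  match l with L2m => g_form s | L2mp1 => h_form s | L2mm1 => kappa_form s end.

Definition Lambda (l : lfun) (s : nat) : fsum R :=
  match l with L2m => G_form s | L2mp1 => H_form s | L2mm1 => K_form s end.

Definition trig_integrand (d : nat) (l : d.-tuple lfun) (s : d.-tuple nat)
    (n : nat) : fsum R :=
  ((\big[fcomp/fone]_(j < d) lambda (tnth l j) (tnth s j))
   ** form (fun t => bfun n (sin t)))%form.

Definition alg_integrand (d : nat) (l : d.-tuple lfun) (s : d.-tuple nat)
    (n : nat) : fsum R :=
  ((\big[fcomp/fone]_(j < d) Lambda (tnth l j) (tnth s j))
   ** form (fun t => bfun n t * omega1 t))%form.

Definition ydomain (s1 : nat) : set R :=
  [set y | if s1 == 1%N then - (pi / 2) < y < pi / 2
           else - (pi / 2) <= y <= pi / 2].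

End Forms.

(* Main.v *)
Require Import Defs.
From HB Require Import structures.
From mathcomp Require Import all_boot all_order all_algebra.
From mathcomp Require Import all_classical all_reals all_analysis.
From mathcomp Require Import measurable_realfun ring lra.
Import Order.TTheory GRing.Theory Num.Theory.
Import numFieldNormedType.Exports.

Local Open Scope classical_set_scope.
Local Open Scope ring_scope.

(* Write [a_m = 4^m / C(2m, m)] and [beta_n y] for the integral of [b_n(sin t)]
   from 0 to [y].  Since [a_m / (2m) = a_(m-1) / (2m-1)], the function
   [cos t sin^(2m-1) t a_m / (2m)] has derivative [b_(m-1)(sin t) - b_m(sin t)];
   telescoping gives [tan y * beta_n y = sum_(m > n) b_m(sin y) / (2m)].  The
   remaining letters act on powers of the sine: integration against [cot]
   divides [sin^j] by [j], and the first and last letters of each block shift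
   the exponent [2m] to [l(m)] and back.  Hence each block [lambda_(l,s)] sends
   [beta_n] to the sum of [beta_m / l(m)^s] over [m] related to [n], and
   composing blocks produces the nested sum, under the integral sign.

   All integrands are positive on [0 < t < pi/2], so these manipulations take
   place in [0, +oo] without convergence conditions, and convergence of the
   iterated integrals follows from finiteness of the sum; negative arguments
   are covered by parity.  With [v_m = a_m / (2m+1)] one has
   [v_m - v_(m+1) = a_m / ((2m+1)(2m+3))], which bounds the nested sums by
   telescoping.  The algebraic statement is the same computation with
   [(sin t, cos t, dt)] replaced by [(t, sqrt (1 - t^2), omega1)]. *)

(** * Coefficients and chain weights *)

(** The derivative is not taken letter by letter, which would require separate limits wherever a
    letter is singular, such as [csc] at 0. By Tonelli the series of [N_m beta_m], with [N_m] the
    chain weight, equals one integral of [rho] times the series of [N_m b_m(sg t)]. This integrand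
    is continuous, so the fundamental theorem of calculus is applied once, at the very end; the
    value [omega1] of [rho] in the algebraic case accounts for the factor [sqrt (1 - x^2)].
    Continuity needs summability at a single dominating point [w]: some [w < 1] in the algebraic
    case and when [s_1 = 1], but [w = 1] when [s_1 >= 2], so as to include the end points. The
    sequence [v_m] has order [m^(-1/2)]. It is chosen because the sum of [v_m / (2m+1)] over
    [m >= k] is again of order [v_k], so that domination by [v] survives any number of blocks. At
    [w = 1] the terms [a_m] have order [m^(1/2)]; the second factor [1 / (2m+1)] provided by
    [s_1 >= 2] brings them under [v] after one step. *)

Section Coefficients.
Context {R : realType}.

Definition acoef (m : nat) : R := 4 ^+ m * ('C(2 * m, m)%:R)^-1.

Definition vcoef (m : nat) : R := acoef m / (2 * m%:R + 1).

Lemma acoef_gt0 m : 0 < acoef m.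
Proof.
rewrite /acoef mulr_gt0 ?exprn_gt0// invr_gt0 ltr0n bin_gt0.
by rewrite leq_pmull.
Qed.

Lemma vcoef_gt0 m : 0 < vcoef m.
Proof. by rewrite /vcoef divr_gt0 ?acoef_gt0// ltr_wpDl. Qed.

Lemma acoefS m : (2 * m%:R + 1) * acoef m.+1 = (2 * m%:R + 2) * acoef m.
Proof.
have mm : ((2 * m).+2 = 2 * m.+1)%N by rewrite mulnS.
have h1 := mul_bin_diag (2 * m.+1) m.
have h2 := mul_bin_down (2 * m).+1 m.
rewrite -mm /= in h1 h2.
(* Passes through [C(2m+1, m)]: [h1] goes down the diagonal from [C(2m+2, m+1)], and [h2] goes down
   the column to [C(2m, m)]. *)
have h3 : (m.+1 * ('C((2 * m).+2, m.+1)) = 2 * (2 * m).+1 * 'C(2 * m, m))%N.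
  have e : ((2 * m).+1 - m = m.+1)%N by rewrite mul2n -addnn -addnS addKn.
  by rewrite e in h2; rewrite -h1 -(mulnA 2%N (2 * m).+1) h2 mulnA mulnS.
rewrite /acoef exprS -mm.
have p : 0 < ('C((2 * m).+2, m.+1))%:R :> R.
  by rewrite ltr0n bin_gt0 mul2n -addnn ltnS leqW ?leq_addr.
have q : 0 < ('C(2 * m, m))%:R :> R by rewrite ltr0n bin_gt0 leq_pmull.
have /(congr1 (fun k => k%:R : R)) := h3.
rewrite !natrM -[in (2 * m).+1%:R]natr1 natrM -natr1 => h4.
apply: (mulIf (lt0r_neq0 p)); apply: (mulIf (lt0r_neq0 q)).
have -> : (2 * m%:R + 1) * (4 * 4 ^+ m / 'C((2 * m).+2, m.+1)%:R)
   * 'C((2 * m).+2, m.+1)%:R * 'C(2 * m, m)%:R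
  = 2 * (4 ^+ m) * (2%:R * (2%:R * m%:R + 1) * 'C(2 * m, m)%:R) :> R.
  by field; rewrite lt0r_neq0.
by rewrite -h4; field; rewrite lt0r_neq0.
Qed.

Lemma acoef_div m : acoef m / (2 * m%:R + 1) = acoef m.+1 / (2 * m.+1%:R).
Proof.
have h := acoefS m; rewrite -natr1 in h *.
have m0 : 0 <= m%:R :> R by [].
have -> : acoef m = (2 * m%:R + 1) * acoef m.+1 / (2 * m%:R + 2).
  by rewrite h mulrAC divff ?mul1r//; lra.
by field; rewrite !lt0r_neq0//; lra.
Qed.

(** The true order is [sqrt m]; this crude bound suffices against the geometric decay of [x^(2m)]
    for [x < 1]. *)
Lemma acoef_le m : acoef m <= 2 * m%:R + 1.
Proof.
elim: m => [|m ih]; first by rewrite /acoef muln0 bin0 expr0; lra.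
have m0 : 0 <= m%:R :> R by [].
have h := acoefS m; rewrite -natr1.
have : (2 * m%:R + 1) * acoef m.+1 <= (2 * m%:R + 2) * (2 * m%:R + 1).
  by rewrite h ler_wpM2l//; lra.
by rewrite mulrC ler_pM2r; lra.
Qed.

Lemma vcoef_telescope m :
  vcoef m - vcoef m.+1 = acoef m / ((2 * m%:R + 1) * (2 * m%:R + 3)).
Proof.
have m0 : 0 <= m%:R :> R by [].
have -> : vcoef m.+1 = (2 * m%:R + 2) * acoef m
   / ((2 * m%:R + 1) * (2 * m%:R + 3)).
  by rewrite -acoefS /vcoef -natr1; field; rewrite !lt0r_neq0//; lra.
by rewrite /vcoef; field; rewrite !lt0r_neq0//; lra.
Qed.

(** The relation excludes [m = 0] for [2m] and [2m-1]. The constant 3 is attained by [2m-1] at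
    [m = 1]. *)
Lemma lval_ge (l : lfun) m k : lsucc l m k ->
  2 * m%:R + 1 <= 3 * lval R l m /\ 1 <= lval R l m.
Proof.
have m0 : 0 <= m%:R :> R by [].
case: l => //= km; (try (by split; lra));
have m1 : 1 <= m%:R :> R by rewrite ler1n (leq_ltn_trans _ km).
- by split; lra.
- by split; lra.
Qed.

(** The kernel of one summation step, from the entry [k] of a chain to the preceding entry [m].
    Cutting it off by 0 turns restricted sums into series over all [m]. *)
Definition step_coef (l : lfun) (s k m : nat) : R :=
  if lsucc l m k then (lval R l m ^+ s)^-1 else 0.

Lemma step_coef_ge0 l s k m : 0 <= step_coef l s k m.
Proof.
rewrite /step_coef; case: ifPn => // /lval_ge[_ h].
by rewrite invr_ge0 exprn_ge0// (le_trans _ h).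
Qed.

Lemma step_coef_eq0 l s k m : (m < k)%N -> step_coef l s k m = 0.
Proof.
move=> mk; rewrite /step_coef; case: ifPn => //.
case: l => /= km; first by move: (ltn_trans km mk); rewrite ltnn.
  by move: (leq_ltn_trans km mk); rewrite ltnn.
by move: (ltn_trans km mk); rewrite ltnn.
Qed.

Lemma step_coef_le l s k m : (0 < s)%N ->
  step_coef l s k m <= 3 / (2 * m%:R + 1).
Proof.
move=> s0; have m0 : 0 <= m%:R :> R by [].
have p : 0 < 2 * m%:R + 1 :> R by lra.
rewrite /step_coef; case: ifPn => [/lval_ge[h h1]|_]; last first.
  by rewrite divr_ge0// ltW.
rewrite -[leRHS]invf_div lef_pV2 ?posrE ?divr_gt0//; last first.
  by rewrite exprn_gt0// (lt_le_trans _ h1).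
rewrite ler_pdivrMr// [leRHS]mulrC; apply: (le_trans h).
by rewrite ler_pM2l// -[leLHS]expr1 ler_weXn2l.
Qed.

Lemma step_coef2_le l s k m : (1 < s)%N ->
  step_coef l s k m <= 9 / (2 * m%:R + 1) ^+ 2.
Proof.
case: s => [//|s]; rewrite ltnS => s0; have m0 : 0 <= m%:R :> R by [].
have p : 0 < 2 * m%:R + 1 :> R by lra.
have -> : step_coef l s.+1 k m = step_coef l 1 k m * step_coef l s k m.
  rewrite /step_coef; case: ifPn; last by rewrite mul0r.
  by rewrite exprS invfM expr1.
have -> : 9 / (2 * m%:R + 1) ^+ 2
   = (3 / (2 * m%:R + 1)) * (3 / (2 * m%:R + 1)) :> R.
  by field; rewrite lt0r_neq0.
by rewrite ler_pM ?step_coef_ge0 ?step_coef_le.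
Qed.

(** The factor 3 replaces [2m+3] by [3(2m+1)] in [vcoef_telescope]. *)
Lemma telescope_bound m :
  acoef m / (2 * m%:R + 1) ^+ 2 <= 3 * (vcoef m - vcoef m.+1).
Proof.
have m0 : 0 <= m%:R :> R by [].
have p : 0 < 2 * m%:R + 1 :> R by lra.
have q : 0 < 2 * m%:R + 3 :> R by lra.
rewrite vcoef_telescope mulrCA ler_pM2l ?acoef_gt0//.
rewrite -[leRHS]invf_div lef_pV2 ?posrE ?divr_gt0 ?mulr_gt0 ?exprn_gt0//.
by rewrite ler_pdivrMr// expr2 -mulrA ler_pM2l//; lra.
Qed.

(** The constant is [3 * 3]: one factor from [lval_ge], one from [telescope_bound]. In
    [step_coef_acoef_le] the factor from [lval_ge] occurs twice, hence 27. *)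
Lemma step_coef_vcoef_le l s k m : (0 < s)%N ->
  step_coef l s k m * vcoef m <= 9 * (vcoef m - vcoef m.+1).
Proof.
move=> s0; have m0 : 0 <= m%:R :> R by [].
apply: (le_trans (ler_wpM2r (ltW (vcoef_gt0 m)) (step_coef_le l s k m s0))).
have -> : 3 / (2 * m%:R + 1) * vcoef m = 3 * (acoef m / (2 * m%:R + 1) ^+ 2).
  by rewrite /vcoef; field; rewrite lt0r_neq0//; lra.
have := telescope_bound m; lra.
Qed.

Lemma step_coef_acoef_le l s k m : (1 < s)%N ->
  step_coef l s k m * acoef m <= 27 * (vcoef m - vcoef m.+1).
Proof.
move=> s0; have m0 : 0 <= m%:R :> R by [].
apply: (le_trans (ler_wpM2r (ltW (acoef_gt0 m)) (step_coef2_le l s k m s0))).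
have -> : 9 / (2 * m%:R + 1) ^+ 2 * acoef m = 9 * (acoef m / (2 * m%:R + 1) ^+ 2).
  by field; rewrite lt0r_neq0//; lra.
have := telescope_bound m; lra.
Qed.

(** The terms start at [k], so the partial sums are at most [c (v_k - v_N)]. A bound by [v_k]
    itself, rather than by a constant, is what allows iteration over the blocks. *)
Lemma telescope_series_le (c : R) (u : nat -> R) k : 0 <= c ->
  (forall m, (m < k)%N -> u m = 0) ->
  (forall m, 0 <= u m <= c * (vcoef m - vcoef m.+1)) ->
  (\sum_(m <oo) (u m)%:E <= (c * vcoef k)%:E)%E.
Proof.
move=> c0 uk ub; apply: lime_le.
  by apply: is_cvg_nneseries => m _ _; rewrite lee_fin; case/andP: (ub m).
apply: nearW => N; rewrite sumEFin lee_fin.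
have [Nk|kN] := leqP N k.
  rewrite big_nat big1 ?mulr_ge0 ?(ltW (vcoef_gt0 k))// => i /andP[_ iN].
  by rewrite uk// (leq_trans iN).
rewrite (@big_cat_nat _ _ _ k)//= ?(ltnW kN)//.
rewrite big_nat big1 ?add0r; last by move=> i /andP[_ ik]; rewrite uk.
apply: (@le_trans _ _ (\sum_(k <= m < N) (c * vcoef m - c * vcoef m.+1))).
  by apply: ler_sum => i _; rewrite -mulrBr; case/andP: (ub i).
rewrite -[leRHS]opprK -[leLHS]opprK lerN2 -sumrN.
under eq_bigr do rewrite opprB.
rewrite telescope_sumr ?(ltnW kN)//.
by rewrite lerBrDl subrr mulr_ge0// ltW// vcoef_gt0.
Qed.

(* The weight of [m] is the sum of [1 / (l_1(n_1)^s_1 ... l_d(n_d)^s_d)] over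
   the chains with [n_1 = m]; it is a finite sum, since chains decrease. *)
Fixpoint chain_weight (l : seq lfun) (s : seq nat) (n m : nat) : R :=
  match l, s with
  | l1 :: l', s1 :: s' =>
      \sum_(k < m.+1) chain_weight l' s' n k * step_coef l1 s1 k m
  | _, _ => (m == n)%:R
  end.

Lemma chain_weight_ge0 l s n m : 0 <= chain_weight l s n m.
Proof.
elim: l s m => [|l1 l ih] [|s1 s] m //=.
by apply: sumr_ge0 => k _; rewrite mulr_ge0 ?step_coef_ge0.
Qed.

Local Open Scope ereal_scope.

Lemma nneseries_single (f : nat -> \bar R) n :
  0 <= f n -> (forall m, m != n -> f m = 0) -> \sum_(m <oo) f m = f n.
Proof.
move=> fn0 f0; rewrite (@nneseriesD1 _ f n)//; last first.
  by move=> k _; have [->//|/f0->] := eqVneq k n.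
by rewrite eseries0 ?adde0// => i _ /andP[_ /f0].
Qed.

Lemma chain_weight_nil n (g : nat -> \bar R) : (forall m, 0 <= g m) ->
  \sum_(m <oo) (chain_weight [::] [::] n m)%:E * g m = g n.
Proof.
move=> g0; rewrite (@nneseries_single _ n)/= ?eqxx ?mul1e//.
by move=> m /negbTE ->; rewrite mul0e.
Qed.

(** Tonelli for series: the outermost index is summed first, with the next index [k] held fixed. The
    inner sum is then a new function of [k], to which induction on the remaining blocks applies. *)
Lemma chain_weight_cons l1 l s1 s n (g : nat -> \bar R) :
  (forall m, 0 <= g m) ->
  \sum_(m <oo) (chain_weight (l1 :: l) (s1 :: s) n m)%:E * g m =
  \sum_(k <oo) (chain_weight l s n k)%:E
     * \sum_(m <oo) (step_coef l1 s1 k m)%:E * g m.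
Proof.
move=> g0; have c0 k m : 0 <= (step_coef l1 s1 k m)%:E * g m.
  by rewrite mule_ge0// lee_fin step_coef_ge0.
have w0 k : 0 <= (chain_weight l s n k)%:E by rewrite lee_fin chain_weight_ge0.
under [RHS]eq_eseriesr do rewrite -nneseriesZl//.
rewrite nneseries_interchange; last by move=> i j; rewrite mule_ge0.
apply: eq_eseriesr => m _.
(* The weight sums over [k <= m] only; the remaining terms of the series vanish by
   [step_coef_eq0]. *)
rewrite (@nneseries_split _ _ 0 m.+1); last by move=> k _; rewrite mule_ge0.
rewrite add0n [X in _ = _ + X]eseries0 ?adde0; last first.
  by move=> k mk _; rewrite step_coef_eq0 ?mul0e ?mule0.
rewrite big_mkord -sumEFin ge0_sume_distrl; last first.
  by move=> k _; rewrite lee_fin mulr_ge0 ?chain_weight_ge0 ?step_coef_ge0.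
by apply: eq_bigr => k _; rewrite EFinM muleA.
Qed.

(** Each block turns a function dominated by [K v] into one dominated by [9 K v]; hence [g] and [K]
    vary in the induction. *)
Lemma chain_weight_vcoef_lty l s n (g : nat -> \bar R) (K : R) :
  size l = size s -> all (fun k => 0 < k)%N s ->
  (forall m, 0 <= g m <= (K * vcoef m)%:E) ->
  \sum_(m <oo) (chain_weight l s n m)%:E * g m < +oo.
Proof.
elim: l s g K => [|l1 l ih] [|s1 s] g K //= sz.
  move=> _ gK; rewrite (@chain_weight_nil n)//.
    by case/andP: (gK n) => _ /le_lt_trans; apply; rewrite ltry.
  by move=> m; case/andP: (gK m).
move=> /andP[s10 sall] gK.
rewrite chain_weight_cons; last by move=> m; case/andP: (gK m).
apply: (ih _ _ (K * 9)%R) => //; first by case: sz.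
move=> k; apply/andP; split.
  apply: nneseries_ge0 => m _ _; rewrite mule_ge0 ?lee_fin ?step_coef_ge0//.
  by case/andP: (gK m).
have K0 : (0 <= K)%R.
  case/andP: (gK 0%N) => g0 gK0; have := le_trans g0 gK0.
  by rewrite lee_fin pmulr_lge0// vcoef_gt0.
have tb : forall m, (0 <= step_coef l1 s1 k m * (K * vcoef m)
    <= K * 9 * (vcoef m - vcoef m.+1))%R.
  move=> m; rewrite !mulr_ge0 ?step_coef_ge0 ?(ltW (vcoef_gt0 _))//= mulrCA -mulrA.
  by rewrite ler_wpM2l// step_coef_vcoef_le.
apply: le_trans (telescope_series_le (K * 9)%R _ k _ _ tb).
- apply: lee_nneseries => [m _ _|m _].
    by rewrite mule_ge0 ?lee_fin ?step_coef_ge0//; case/andP: (gK m).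
  rewrite EFinM lee_wpmul2l ?lee_fin ?step_coef_ge0//; by case/andP: (gK m).
- by rewrite mulr_ge0.
- by move=> m mk; rewrite step_coef_eq0// mul0r.
Qed.

Lemma chain_weight_acoef_lty l1 l s1 s n : (1 < s1)%N ->
  size l = size s -> all (fun k => 0 < k)%N s ->
  \sum_(m <oo) (chain_weight (l1 :: l) (s1 :: s) n m)%:E * (acoef m)%:E < +oo.
Proof.
move=> s1_gt1 sz sall.
rewrite chain_weight_cons; last by move=> m; rewrite lee_fin ltW// acoef_gt0.
apply: (@chain_weight_vcoef_lty _ _ _ _ 27%R) => //.
move=> k; apply/andP; split.
  apply: nneseries_ge0 => m _ _.
  by rewrite mule_ge0 ?lee_fin ?step_coef_ge0// ltW// acoef_gt0.
have tb : forall m, (0 <= step_coef l1 s1 k m * acoef m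
    <= 27 * (vcoef m - vcoef m.+1))%R.
  move=> m; rewrite !mulr_ge0 ?step_coef_ge0 ?(ltW (acoef_gt0 _))//=.
  exact: step_coef_acoef_le.
apply: (telescope_series_le 27%R _ k _ _ tb) => //.
by move=> m mk; rewrite step_coef_eq0// mul0r.
Qed.

End Coefficients.

(** * Nested sums and power series *)

Section NestedSums.
Context {R : realType}.

(** With an empty tail, the default value of [head n ns] makes the condition a comparison of [m]
    with [n]. *)
Lemma chains_cons d (l1 : lfun) (l : d.-tuple lfun) n m (ns : d.-tuple nat) :
  chains [tuple of l1 :: l] n [tuple of m :: ns] <->
  chains l n ns /\ lsucc l1 m (head n ns).
Proof.
split=> [h|[h h0] j].
  split=> [j|].
    by have := h (lift ord0 j); rewrite !tnthS /= /bump leq0n.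
  by have := h ord0; rewrite !(tnth_nth l1) !(tnth_nth 0%N)/= nth0.
have [->|[k ->]] : j = ord0 \/ exists k, j = lift ord0 k.
- by case: (unliftP ord0 j) => [k ->|->]; [right; exists k|left].
- by rewrite !(tnth_nth l1) !(tnth_nth 0%N)/= nth0.
- by have := h k; rewrite !tnthS /= /bump leq0n.
Qed.

Lemma chain_prod_ge0 d (l : d.-tuple lfun) (s : d.-tuple nat) n
    (ns : d.-tuple nat) : chains l n ns ->
  0 <= \prod_(j < d) lval R (tnth l j) (tnth ns j) ^+ tnth s j.
Proof.
move=> h; apply: prodr_ge0 => j _; rewrite exprn_ge0//.
by have [_ /(le_trans _)->] := lval_ge (R:=R) _ _ _ (h j).
Qed.

Local Open Scope ereal_scope.

(** For a fixed tail, the range of the first index depends only on the head of that tail. Summing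
    over the first index therefore yields a new [g] evaluated at that head, and the induction
    continues with it. *)
Lemma esum_chains d (l : d.-tuple lfun) (s : d.-tuple nat) n
    (g : nat -> \bar R) : (forall m, 0 <= g m) ->
  \esum_(ns in chains l n)
     ((\prod_(j < d) lval R (tnth l j) (tnth ns j) ^+ tnth s j)^-1)%:E
       * g (head n ns)
  = \sum_(m <oo) (chain_weight l s n m)%:E * g m.
Proof.
elim: d l s g => [|d ih] l s g g0.
  rewrite tuple0 [s]tuple0 chain_weight_nil//.
  have -> : chains [tuple] n = [set [tuple]].
    by apply/seteqP; split=> [ns _|ns _ []//]; rewrite /= tuple0.
  by rewrite esum_set1 big_ord0 invr1 mul1e/=.
case/tupleP: l => l1 l; case/tupleP: s => s1 s.
rewrite chain_weight_cons// -ih; last first.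
  move=> k; apply: nneseries_ge0 => m _ _.
  by rewrite mule_ge0// lee_fin step_coef_ge0.
rewrite (reindex_esum (chains l n `*`` fun ns => [set m | lsucc l1 m (head n ns)])
  _ (fun p => [tuple of p.2 :: p.1])); last first.
  split=> [[ns m]/= [h1 h2]|[ns m] [ns' m'] _ _ /=|ns].
  - exact/chains_cons.
  - by move=> [] -> e; congr pair; apply: val_inj.
  - case/tupleP: ns => m ns /chains_cons[h1 h2]; by exists (ns, m).
pose F (ns : d.-tuple nat) m := ((lval R l1 m ^+ s1 *
  \prod_(i < d) lval R (tnth l i) (tnth ns i) ^+ tnth s i)^-1)%:E * g m.
have F0 ns m : chains l n ns -> lsucc l1 m (head n ns) -> 0 <= F ns m.
  move=> h1 h2; rewrite mule_ge0// lee_fin invr_ge0 mulr_ge0//.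
    by rewrite exprn_ge0//; have [_ /(le_trans _)->] := lval_ge (R:=R) _ _ _ h2.
  exact: (chain_prod_ge0 _ _ _ n).
transitivity (\esum_(p in chains l n `*`` fun ns => [set m | lsucc l1 m (head n ns)])
    F p.1 p.2).
  apply: eq_esum => -[ns m] _ /=; rewrite big_ord_recl !tnth0.
  by under eq_bigr do rewrite !tnthS.
rewrite -(@esum_esum _ _ _ _ _ F)//.
apply: eq_esum => ns h.
rewrite -nneseriesZl; last first.
  by move=> m _; rewrite mule_ge0// lee_fin step_coef_ge0.
rewrite -nneseries_esum; last by move=> m; exact: F0.
rewrite eseries_mkcond; apply: eq_eseriesr => m _.
rewrite /F /step_coef; case: ifPn => _; last by rewrite mul0e mule0.
by rewrite muleA -EFinM invfM mulrC.
Qed.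

(** Nonemptiness reconciles the default values of [head]: 0 in [nested_sum], [n] in
    [esum_chains]. *)
Lemma nested_sumE d (l : d.-tuple lfun) (s : d.-tuple nat) n (x : R) :
  (0 < d)%N ->
  nested_sum l s n x
  = \sum_(m <oo) (chain_weight l s n m)%:E * (bfun m x)%:E.
Proof.
move=> d0; rewrite -(@esum_chains d l s n (fun m => (bfun m x)%:E)); last first.
  move=> m; rewrite lee_fin mulr_ge0 ?(ltW (acoef_gt0 m))//.
  by rewrite mul2n -addnn exprD sqr_ge0.
apply: eq_esum => ns _; rewrite -EFinM mulrC; congr (_ * bfun _ x)%:E.
by case: d d0 l s ns => // d _ l s ns; case/tupleP: ns.
Qed.

Local Open Scope ring_scope.

(** Bernoulli's inequality with [1/x = 1 + h] bounds [x^m] by [1 / (1 + m h)], so that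
    [(2m+1) x^m <= 1 + 2/h]; then both sides are squared. *)
Lemma sqr_expr_bounded (x : R) : 0 <= x < 1 ->
  exists2 K, 0 < K & forall m, (2 * m%:R + 1) ^+ 2 * x ^+ (2 * m) <= K.
Proof.
move=> /andP[]; rewrite le_eqVlt => /predU1P[<- _|x0 x1].
  exists 1 => // -[|m]; first by rewrite muln0 expr0; lra.
  by rewrite mulnS expr0n mulr0.
pose h := x^-1 - 1.
have h0 : 0 < h by rewrite subr_gt0 invf_gt1.
exists ((1 + 2 / h) ^+ 2) => [|m].
  by rewrite exprn_gt0// addr_gt0// divr_gt0.
have B : 1 + m%:R * h <= x ^- m.
  have -> : x ^- m = (1 + h) ^+ m by rewrite /h addrC subrK exprVn.
  elim: m => [|m ih]; first by rewrite mul0r addr0 expr0.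
  have m0 : 0 <= m%:R :> R by [].
  rewrite exprS; apply: (@le_trans _ _ ((1 + h) * (1 + m%:R * h))).
    by rewrite -natr1; nra.
  by rewrite ler_pM2l//; lra.
have p : 0 < 1 + m%:R * h by rewrite ltr_pwDl// mulr_ge0// ltW.
rewrite mulnC exprM -exprMn -subr_ge0 subr_sqr mulr_ge0//; last first.
  by rewrite addr_ge0// ?mulr_ge0 ?addr_ge0 ?divr_ge0 ?exprn_ge0// ltW.
rewrite subr_ge0.
have xm : x ^+ m <= (1 + m%:R * h)^-1.
  by rewrite -[leLHS]invrK lef_pV2 ?posrE ?invr_gt0 ?exprn_gt0.
apply: (@le_trans _ _ ((2 * m%:R + 1) * (1 + m%:R * h)^-1)).
  by rewrite ler_wpM2l// addr_ge0// mulr_ge0.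
rewrite ler_pdivrMr//.
have -> : (1 + 2 / h) * (1 + m%:R * h) = 2 * m%:R + 1 + (m%:R * h + 2 / h).
  by field; rewrite lt0r_neq0.
have h0' := ltW h0.
by rewrite lerDl addr_ge0 ?mulr_ge0 ?invr_ge0.
Qed.

Lemma bfun_le_vcoef (x : R) : 0 <= x < 1 ->
  exists K, forall m, bfun m x <= K * vcoef m.
Proof.
move=> /[dup] /andP[x0 _] /sqr_expr_bounded[K K0 hK]; exists K => m.
have p : 1 <= 2 * m%:R + 1 :> R by rewrite lerDr mulr_ge0.
rewrite /bfun -/(acoef m) /vcoef mulrCA ler_pM2l ?acoef_gt0//.
rewrite ler_pdivlMr ?(lt_le_trans _ p)//.
apply: le_trans (hK m); rewrite mulrC ler_wpM2r ?exprn_ge0//.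
by rewrite ler_eXnr.
Qed.

Lemma bfun_cvg0 (x : R) : 0 <= x < 1 -> bfun m x @[m --> \oo] --> 0.
Proof.
move=> /[dup] /andP[x0 _] /sqr_expr_bounded[K K0 hK].
have Ki : K * (m.+1%:R)^-1 @[m --> \oo] --> 0.
  rewrite -[X in _ --> X](mulr0 K); apply: cvgMr; exact: cvg_harmonic.
apply: (squeeze_cvgr _ (cvg_cst 0) Ki); apply: nearW => m; apply/andP; split.
  by rewrite mulr_ge0 ?(ltW (acoef_gt0 m))// exprn_ge0.
have m0 : 0 <= m%:R :> R by [].
have p : 1 <= 2 * m%:R + 1 :> R by rewrite lerDr mulr_ge0.
rewrite ler_pdivlMr ?ltr0n//; apply: le_trans (hK m).
rewrite /bfun -/(acoef m) mulrAC ler_wpM2r ?exprn_ge0//.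
rewrite expr2 ler_pM ?(ltW (acoef_gt0 m)) ?acoef_le//.
by rewrite -natr1; lra.
Qed.

Definition clamp (c x : R) : R := Num.max (- c) (Num.min c x).

Lemma clamp_continuous (c : R) : continuous (clamp c).
Proof.
move=> x; apply: (@continuous_max R R (cst (- c))); first exact: cvg_cst.
by apply: (@continuous_min R R (cst c)); [exact: cvg_cst|exact: cvg_id].
Qed.

Lemma clamp_le (c x : R) : 0 <= c -> - c <= clamp c x <= c.
Proof.
by move=> c0; rewrite /clamp le_max lexx/= ge_max ge_min lexx/= andbT; lra.
Qed.

Lemma clamp_id (c x : R) : - c <= x <= c -> clamp c x = x.
Proof.
by move=> /andP[h1 h2]; rewrite /clamp (min_idPr h2) (max_idPr h1).
Qed.

Lemma clampN (c x : R) : 0 <= c -> clamp c (- x) = - clamp c x.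
Proof.
move=> c0; rewrite /clamp oppr_max oppr_min opprK max_minr.
by rewrite (max_idPr _)//; lra.
Qed.

(* Weierstrass' M-test: the tails are dominated by those at [w]. *)
Lemma clamped_series_continuous (c : nat -> R) (w : R) : 0 <= w ->
  (forall m, 0 <= c m) ->
  (\sum_(m <oo) (c m * w ^+ (2 * m))%:E < +oo)%E ->
  continuous (fun x => fine (\sum_(m <oo) (c m * clamp w x ^+ (2 * m))%:E)).
Proof.
move=> w0 c0 fin.
have even_ge0 (x : R) m : 0 <= x ^+ (2 * m).
  by rewrite mul2n -addnn exprD sqr_ge0.
have t0 x m : (0 <= (c m * clamp w x ^+ (2 * m))%:E)%E.
  by rewrite lee_fin mulr_ge0.
have tw x m : (c m * clamp w x ^+ (2 * m) <= c m * w ^+ (2 * m)).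
  rewrite ler_wpM2l// !(exprM _ 2) lerXn2r ?nnegrE ?sqr_ge0//.
  by have /andP[] := clamp_le w x w0; nra.
have tl x N : (\sum_(N <= m <oo) (c m * clamp w x ^+ (2 * m))%:E
     <= \sum_(N <= m <oo) (c m * w ^+ (2 * m))%:E)%E.
  by apply: lee_nneseries => m _ //; rewrite lee_fin.
have wf N : (\sum_(N <= m <oo) (c m * w ^+ (2 * m))%:E < +oo)%E.
  apply: le_lt_trans fin; rewrite [leRHS](@nneseries_split _ _ 0 N)//; last first.
    by move=> m _; rewrite lee_fin mulr_ge0.
  by rewrite add0n leeDr// sume_ge0// => m _; rewrite lee_fin mulr_ge0.
have tf x N : (\sum_(N <= m <oo) (c m * clamp w x ^+ (2 * m))%:E)%E
    \is a fin_num.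
  rewrite ge0_fin_numE; last by apply: nneseries_ge0.
  exact: le_lt_trans (tl x N) (wf N).
have st (N : nat) x : fine (\sum_(m <oo) (c m * clamp w x ^+ (2 * m))%:E)
  - \sum_(0 <= m < N) c m * clamp w x ^+ (2 * m)
  = fine (\sum_(N <= m <oo) (c m * clamp w x ^+ (2 * m))%:E).
  rewrite (@nneseries_split _ _ 0 N)// add0n sumEFin fineD//.
  by rewrite addrC addKr.
have tcv : (\sum_(N <= m <oo) (c m * w ^+ (2 * m))%:E @[N --> \oo] --> 0)%E.
  by apply: nneseries_tail_cvg => // k _; rewrite lee_fin mulr_ge0.
have [_ ftcv] := (fine_cvgP _ _).1 tcv.
move=> x; apply/cvgrPdist_lt => e e0.
have e3 : 0 < e / 3 by rewrite divr_gt0.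
have [N hN] := filter_ex (cvgr_lt _ ftcv _ e3).
have tlN y : `|fine (\sum_(m <oo) (c m * clamp w y ^+ (2 * m))%:E)
    - \sum_(0 <= m < N) c m * clamp w y ^+ (2 * m)| < e / 3.
  rewrite st ger0_norm ?fine_ge0 ?nneseries_ge0//.
  apply: le_lt_trans hN; apply: fine_le => //.
  rewrite ge0_fin_numE//; apply: nneseries_ge0 => m _ _.
  by rewrite lee_fin mulr_ge0.
have pc : (fun y => \sum_(0 <= m < N) c m * clamp w y ^+ (2 * m)) @ x
    --> \sum_(0 <= m < N) c m * clamp w x ^+ (2 * m).
  apply: cvg_big => [|m _]; first exact: add_continuous.
  apply: cvgMr; apply: (@continuous_comp _ _ _ (clamp w) (fun z => z ^+ (2 * m))).
    exact: clamp_continuous.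
  exact: exprn_continuous.
have /cvgrPdist_lt/(_ _ e3) := pc; apply: filterS => y hy.
set Sx := fine _; set Sy := fine _; move: hy (tlN x) (tlN y); rewrite -/Sx -/Sy.
rewrite !ltr_norml => /andP[h1 h2] /andP[h3 h4] /andP[h5 h6].
by apply/andP; split; lra.
Qed.

End NestedSums.

(** * Iterated integrals of positive forms *)

Section Words.
Context {R : realType}.

(** A conjunction in [Prop], in the shape of [convergent]: the properties of letters are not
    boolean. *)
Definition all_letters (Q : (R -> R) -> Prop) (w : word R) : Prop :=
  foldr (fun f => and (Q f)) True w.

Definition all_words (Q : word R -> Prop) (P : fsum R) : Prop :=
  foldr (fun w => and (Q w)) True P.

Lemma all_letters_cat Q (u w : word R) :
  all_letters Q u -> all_letters Q w -> all_letters Q (u ++ w).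
Proof. by elim: u => //= f u ih [Qf /ih h] /h. Qed.

Lemma all_letters_nseq (Q : (R -> R) -> Prop) k f :
  Q f -> all_letters Q (nseq k f).
Proof. by move=> Qf; elim: k. Qed.

Lemma all_words_impl (Q1 Q2 : word R -> Prop) (P : fsum R) :
  (forall w, Q1 w -> Q2 w) -> all_words Q1 P -> all_words Q2 P.
Proof. by move=> h; elim: P => //= w P ih [/h ? /ih]. Qed.

Lemma all_words_cat Q (P P' : fsum R) :
  all_words Q P -> all_words Q P' -> all_words Q (P ++ P').
Proof. by elim: P => //= w P ih [? /ih h] /h. Qed.

Lemma all_words_comp (Q1 Q2 Q3 : word R -> Prop) (P P' : fsum R) :
  (forall u w, Q1 u -> Q2 w -> Q3 (u ++ w)) ->
  all_words Q1 P -> all_words Q2 P' -> all_words Q3 (P ** P')%form.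
Proof.
move=> h + P'2; elim: P => //= u P ih [Qu /ih QP].
rewrite /fcomp allpairs_cons; apply: all_words_cat => //.
by elim: P' P'2 {ih QP} => //= w P' ih [/(h _ _ Qu) ? /ih].
Qed.

Lemma fpow_form (f : R -> R) k : fpow (Defs.form f) k = [:: nseq k f].
Proof. by elim: k => //= k ->. Qed.

Lemma fcomp_cons (u : word R) (P Q : fsum R) :
  ((u :: P) ** Q)%form = map (cat u) Q ++ (P ** Q)%form.
Proof. by []. Qed.

Lemma fcomp_catl (P P' Q : fsum R) :
  ((P ++ P') ** Q)%form = (P ** Q)%form ++ (P' ** Q)%form.
Proof. by elim: P => // u P ih; rewrite cat_cons !fcomp_cons ih catA. Qed.

Lemma fcompA (P Q S : fsum R) : (P ** (Q ** S) = P ** Q ** S)%form.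
Proof.
elim: P => // u P ih; rewrite !fcomp_cons ih fcomp_catl; congr cat.
elim: Q {ih} => // v Q ihQ; rewrite !fcomp_cons map_cat ihQ; congr cat.
by rewrite -map_comp; apply: eq_map => w /=; rewrite catA.
Qed.

Lemma comp1f (P : fsum R) : (1 ** P)%form = P.
Proof. by rewrite /fcomp /fone /= cats0 map_id. Qed.

End Words.

Section Steps.
Context {R : realType}.
Variable A : R.
Local Notation mu := (@lebesgue_measure R).
Local Open Scope ereal_scope.

(** Superlevel sets are intervals. Iterated integrals of positive forms are monotone in their end
    point, so this gives their measurability without Fubini. *)
Lemma nondecreasing_emeasurable (a b : R) (phi : R -> \bar R) :
  (forall s t, (a < s)%R -> (s <= t)%R -> (t < b)%R -> phi s <= phi t) ->
  measurable_fun `]a, b[ phi.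
Proof.
move=> nd; apply: (measurability (@ErealGenCInfty.G R)) => [|/= _ [_] [r] -> <-].
  exact: ErealGenCInfty.measurableE.
apply: is_interval_measurable => s t/=.
rewrite !in_itv/= => -[/andP[s0 sb] rs] [/andP[t0 tb] rt] u /andP[su ut].
have u0 : (a < u)%R by rewrite (lt_le_trans s0).
have ub : (u < b)%R by rewrite (le_lt_trans ut).
rewrite in_itv/= u0 ub; split => //; move: rs; rewrite !in_itv/= !andbT => rs.
by rewrite (le_trans rs)// nd.
Qed.

(** One layer of an iterated integral with values in [[0, +oo]], meaningful before convergence is
    known. *)
Definition estep (f : R -> R) (phi : R -> \bar R) (y : R) : \bar R :=
  \int[mu]_(t in `]0%R, y[) ((f t)%:E * phi t).

(** Nonnegativity includes [t = A], because iterated integrals are also evaluated at the end point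
    [pi / 2]. *)
Definition good (phi : R -> \bar R) :=
  measurable_fun `]0%R, A[ phi /\ forall t, (0 < t <= A)%R -> 0 <= phi t.

Definition pos_form (f : R -> R) :=
  measurable_fun `]0%R, A[ f /\ forall t, (0 < t < A)%R -> (0 < f t)%R.

Lemma sub_itv0 (y : R) : (y <= A)%R -> `]0%R, y[ `<=` `]0%R, A[.
Proof.
move=> yA t /=; rewrite !in_itv/= => /andP[-> ty]/=; exact: lt_le_trans ty yA.
Qed.

Lemma good_integrand f phi (y : R) : pos_form f -> good phi -> (y <= A)%R ->
  measurable_fun `]0%R, y[ (fun t => (f t)%:E * phi t) /\
  (forall t, `]0%R, y[%classic t -> 0 <= (f t)%:E * phi t).
Proof.
move=> [mf f0] [mphi phi0] yA; split.
  apply: (measurable_funS _ (sub_itv0 y yA)) => //.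
  by apply: emeasurable_funM => //; exact/measurable_EFinP.
move=> t /(sub_itv0 y yA); rewrite /= in_itv/= => /[dup] h /andP[t0 tA].
by rewrite mule_ge0 ?lee_fin ?(ltW (f0 t h))// phi0// t0 ltW.
Qed.

Lemma estep_nd f phi (s t : R) : pos_form f -> good phi -> (s <= t)%R ->
  (t <= A)%R -> estep f phi s <= estep f phi t.
Proof.
move=> pf gphi st tA; have [mfp fp0] := good_integrand _ _ _ pf gphi tA.
apply: ge0_subset_integral => //.
by move=> u /=; rewrite !in_itv/= => /andP[-> us]/=; exact: lt_le_trans us st.
Qed.

Lemma estep_good f phi : pos_form f -> good phi -> good (estep f phi).
Proof.
move=> pf gphi; split.
  apply: nondecreasing_emeasurable => s t _ st tA.
  by apply: estep_nd => //; exact: ltW.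
move=> t /andP[t0 tA]; apply: integral_ge0 => u tu.
by have [_ ->] := good_integrand _ _ _ pf gphi tA.
Qed.

Lemma eq_estep f g phi psi (y : R) : (y <= A)%R ->
  (forall t, (0 < t < A)%R -> (f t)%:E * phi t = (g t)%:E * psi t) ->
  estep f phi y = estep g psi y.
Proof.
move=> yA e; apply: eq_integral => t; rewrite inE => /(sub_itv0 y yA).
by rewrite /= in_itv/=; exact: e.
Qed.

Lemma estepD f phi psi (y : R) : pos_form f -> good phi -> good psi ->
  (y <= A)%R ->
  estep f (fun t => phi t + psi t) y = estep f phi y + estep f psi y.
Proof.
move=> pf gphi gpsi yA; have [m1 p1] := good_integrand _ _ _ pf gphi yA.
have [m2 p2] := good_integrand _ _ _ pf gpsi yA.
rewrite /estep -ge0_integralD//; apply: eq_integral => t.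
rewrite inE => /(sub_itv0 y yA)/=; rewrite in_itv/= => /andP[t0 tA].
by rewrite ge0_muleDr//; [case: gphi => _|case: gpsi => _]; apply; rewrite t0 ltW.
Qed.

Lemma estepZ f (c : R) phi (y : R) : pos_form f -> good phi -> (0 <= c)%R ->
  (y <= A)%R ->
  estep f (fun t => c%:E * phi t) y = c%:E * estep f phi y.
Proof.
move=> pf gphi c0 yA; have [m1 p1] := good_integrand _ _ _ pf gphi yA.
rewrite /estep -ge0_integralZl_EFin//; apply: eq_integral => t _.
by rewrite muleCA.
Qed.

Lemma good_cst (c : R) : (0 <= c)%R -> good (fun=> c%:E).
Proof. by move=> c0; split. Qed.

Lemma goodD phi psi : good phi -> good psi -> good (fun t => phi t + psi t).
Proof.
move=> [m1 p1] [m2 p2]; split; first exact: emeasurable_funD.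
by move=> t h; rewrite adde_ge0 ?p1 ?p2.
Qed.

Lemma goodZ (c : R) phi : (0 <= c)%R -> good phi -> good (fun t => c%:E * phi t).
Proof.
move=> c0 [m p]; split; first exact: measurable_funeM.
by move=> t h; rewrite mule_ge0 ?lee_fin ?p.
Qed.

Lemma estep_series f (phi : nat -> R -> \bar R) (y : R) : pos_form f ->
  (forall k, good (phi k)) -> (y <= A)%R ->
  estep f (fun t => \sum_(k <oo) phi k t) y = \sum_(k <oo) estep f (phi k) y.
Proof.
move=> pf gphi yA.
have h k := good_integrand _ _ _ pf (gphi k) yA.
rewrite /estep -integral_nneseries//; last 2 first.
  by move=> k; case: (h k).
  by move=> k t ty; case: (h k) => _; apply.
apply: eq_integral => t; rewrite inE => /(sub_itv0 y yA)/=.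
rewrite in_itv/= => /andP[t0 tA]; rewrite nneseriesZl// => k _.
by case: (gphi k) => _; apply; rewrite t0 ltW.
Qed.

Lemma good0 : good (fun=> 0).
Proof. by split. Qed.

(** A word acts as an operator on the innermost function [phi], so concatenation becomes
    composition; [phi = 1] corresponds to [iterint_word]. *)
Definition eword (w : word R) (phi : R -> \bar R) := foldr estep phi w.

Lemma eword_good w phi : all_letters pos_form w -> good phi -> good (eword w phi).
Proof.
by move=> + gphi; elim: w => //= f w ih [pf /ih gw]; exact: estep_good.
Qed.

Lemma eq_eword w phi psi (y : R) : (forall t, (0 < t <= A)%R -> phi t = psi t) ->
  (0 < y <= A)%R -> eword w phi y = eword w psi y.
Proof.
move=> e; elim: w y => [|f w ih] y y0 /=; first exact: e.
case/andP: y0 => _ yA; apply: eq_estep => // t /andP[t0 tA].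
by rewrite ih// t0 ltW.
Qed.

Lemma ewordD w phi psi (y : R) : all_letters pos_form w -> good phi ->
  good psi -> (0 < y <= A)%R ->
  eword w (fun t => phi t + psi t) y = eword w phi y + eword w psi y.
Proof.
move=> + gphi gpsi; elim: w y => //= f w ih y [pf pw] /andP[y0 yA].
rewrite -estepD//; [|exact: eword_good..].
apply: eq_estep => // t /andP[t0 tA]; congr (_ * _).
by apply: ih => //; rewrite t0 ltW.
Qed.

Lemma eword0 w (y : R) : all_letters pos_form w -> (0 < y <= A)%R ->
  eword w (fun=> 0) y = 0.
Proof.
elim: w y => //= f w ih y [pf pw] /andP[y0 yA].
rewrite /estep integral0_eq// => t /(sub_itv0 y yA)/=.
rewrite in_itv/= => /andP[t0 tA].
by rewrite ih ?mule0// t0 ltW.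
Qed.

(** Monotone convergence, applied once per letter: a block may act termwise on a series whose
    convergence is not yet known. *)
Lemma eword_scaled_series w (c : nat -> R) (phi : nat -> R -> \bar R) (y : R) :
  all_letters pos_form w -> (forall k, 0 <= c k)%R -> (forall k, good (phi k)) ->
  (0 < y <= A)%R ->
  eword w (fun t => \sum_(k <oo) (c k)%:E * phi k t) y
  = \sum_(k <oo) (c k)%:E * eword w (phi k) y.
Proof.
move=> + c0 gphi; elim: w y => //= f w ih y [pf pw] /andP[y0 yA].
transitivity (estep f (fun t => \sum_(k <oo) (c k)%:E * eword w (phi k) t) y).
  apply: eq_estep => // t /andP[t0 tA]; congr (_ * _).
  by apply: ih => //; rewrite t0 ltW.
have gw k : good (eword w (phi k)) by exact: eword_good.
rewrite estep_series//; last by move=> k; exact: goodZ.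
by apply: eq_eseriesr => k _; rewrite estepZ.
Qed.

Definition esum_words (P : fsum R) (phi : R -> \bar R) (y : R) : \bar R :=
  \sum_(w <- P) eword w phi y.

Lemma esum_words_good P phi : all_words (all_letters pos_form) P -> good phi ->
  good (esum_words P phi).
Proof.
move=> + gphi; elim: P => [_|w P ih /= [pw /ih gP]].
  by rewrite /esum_words; under eq_fun do rewrite big_nil; exact: good0.
rewrite /esum_words; under eq_fun do rewrite big_cons.
by apply: goodD => //; exact: eword_good.
Qed.

Lemma eq_esum_words P phi psi (y : R) :
  (forall t, (0 < t <= A)%R -> phi t = psi t) ->
  (0 < y <= A)%R -> esum_words P phi y = esum_words P psi y.
Proof. by move=> e y0; apply: eq_bigr => w _; exact: eq_eword. Qed.

Lemma esum_words_comp P Q phi (y : R) : all_words (all_letters pos_form) P ->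
  all_words (all_letters pos_form) Q -> good phi -> (0 < y <= A)%R ->
  esum_words (P ** Q)%form phi y = esum_words P (esum_words Q phi) y.
Proof.
move=> + pQ gphi y0; rewrite /esum_words /fcomp.
elim: P => [_|u P ih /= [pu pP]]; first by rewrite !big_nil.
rewrite big_cat /= ih// big_cons; congr (_ + _); rewrite big_map.
rewrite -/(esum_words _ _); elim: Q pQ {ih} => [_|w Q ih /= [pw pQ]].
  rewrite big_nil (eq_eword _ _ (fun=> 0))// ?eword0// => t _.
  by rewrite /esum_words big_nil.
rewrite big_cons ih// -[X in X + _]/(foldr estep phi (u ++ w) y).
rewrite foldr_cat -/(eword u (eword w phi) y) -ewordD//.
- by apply: eq_eword => // t _; rewrite /esum_words big_cons.
- exact: eword_good.
- exact: esum_words_good.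
Qed.

Lemma esum_words_scaled_series P (c : nat -> R) (phi : nat -> R -> \bar R)
    (y : R) : all_words (all_letters pos_form) P ->
  (forall k, 0 <= c k)%R -> (forall k, good (phi k)) -> (0 < y <= A)%R ->
  esum_words P (fun t => \sum_(k <oo) (c k)%:E * phi k t) y
  = \sum_(k <oo) (c k)%:E * esum_words P (phi k) y.
Proof.
move=> + c0 gphi y0; elim: P => [_|w P ih /= [pw pP]].
  rewrite /esum_words big_nil eseries0// => k _ _.
  by rewrite big_nil mule0.
rewrite /esum_words big_cons eword_scaled_series// -/(esum_words P _ y) ih//.
rewrite -nneseriesD.
- apply: eq_eseriesr => k _; rewrite /esum_words big_cons ge0_muleDr//.
    by have [_ ->] := eword_good w _ pw (gphi k).
  by have [_ ->] := esum_words_good P _ pP (gphi k).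
- move=> k _; rewrite mule_ge0 ?lee_fin//.
  by have [_ ->] := eword_good w _ pw (gphi k).
- move=> k _; rewrite mule_ge0 ?lee_fin//.
  by have [_ ->] := esum_words_good P _ pP (gphi k).
Qed.

Lemma eword_nd w (s t : R) : all_letters pos_form w -> (s <= t)%R ->
  (t <= A)%R -> eword w (fun=> 1) s <= eword w (fun=> 1) t.
Proof.
case: w => //= f w [pf pw] st tA; apply: estep_nd => //.
by apply: eword_good => //; exact: good_cst.
Qed.

(* A positive integrand with finite integral over ]0, y[ is finite somewhere
   above each t < y, hence at t by monotonicity. *)
Lemma convergent_eword w (y : R) : all_letters pos_form w -> (0 < y <= A)%R ->
  eword w (fun=> 1) y < +oo ->
  convergent_word w y /\ (iterint_word w y)%:E = eword w (fun=> 1) y.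
Proof.
elim: w y => //= f w ih y [pf pw] /andP[y0 yA] fin.
have gw : good (eword w (fun=> 1)) by apply: eword_good => //; exact: good_cst.
have seg : segment0 y = `]0%R, y[%classic.
  by rewrite /segment0 (min_idPl (ltW y0)) (max_idPr (ltW y0)).
have [mfw fw0] := good_integrand _ _ _ pf gw yA.
have wfin t : (0 < t < y)%R -> eword w (fun=> 1) t < +oo.
  move=> /andP[t0 ty]; rewrite ltNge leye_eq; apply/negP => /eqP wt.
  move: fin; apply/negP; rewrite -leNgt leye_eq; apply/eqP.
  apply/eqP; rewrite -leye_eq.
  have sub : `]t, y[ `<=` `]0%R, y[.
    by move=> u /=; rewrite !in_itv/= => /andP[tu ->]; rewrite (lt_trans t0).
  apply: (@le_trans _ _ (\int[mu]_(u in `]t, y[) ((f u)%:E * eword w (fun=> 1) u))).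
    rewrite (@eq_integral _ _ _ _ _ (cst +oo)); last first.
      move=> u; rewrite inE/= in_itv/= => /andP[tu uy].
      have -> : eword w (fun=> 1) u = +oo.
        apply/eqP; rewrite -leye_eq -wt; apply: eword_nd => //; first exact: ltW.
        by rewrite (le_trans (ltW uy)).
      rewrite gt0_muley// lte_fin; case: pf => _; apply.
      by rewrite (lt_trans t0 tu) (lt_le_trans uy).
    rewrite integral_cst//= lebesgue_measure_itv/= lte_fin ty -EFinD.
    by rewrite gt0_mulye// lte_fin subr_gt0.
  exact: ge0_subset_integral.
have wt t : segment0 y t ->
    convergent_word w t /\ (iterint_word w t)%:E = eword w (fun=> 1) t.
  rewrite seg/= in_itv/= => /[dup] ty /andP[t0 ty'].
  apply: ih => //; last exact: wfin.
  by rewrite t0 (le_trans (ltW ty')).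
have eqi : {in `]0%R, y[%classic, (fun t => (f t * iterint_word w t)%:E)
    =1 (fun t => (f t)%:E * eword w (fun=> 1) t)}.
  by move=> t; rewrite inE -seg => /wt[_ <-]; rewrite EFinM.
have int : mu.-integrable `]0%R, y[ (fun t => (f t * iterint_word w t)%:E).
  apply/integrableP; split.
    by apply: eq_measurable_fun mfw => t /eqi ->.
  apply: le_lt_trans fin; rewrite le_eqVlt; apply/orP; left; apply/eqP.
  apply: eq_integral => t ty; rewrite [(f t * _)%:E]eqi// gee0_abs// fw0//.
  by rewrite inE in ty.
split; first by rewrite seg; split => // t; rewrite -seg => /wt[].
rewrite /integral_from0 gtr0_sg// mul1r seg /Rintegral fineK.
  exact: eq_integral.
exact: integrable_fin_num.
Qed.

(** All words contribute nonnegatively, so finiteness of the total gives finiteness of each of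
    them. *)
Lemma convergent_esum_words P (y : R) : all_words (all_letters pos_form) P ->
  (0 < y <= A)%R -> esum_words P (fun=> 1) y < +oo ->
  convergent P y /\ (iterint P y)%:E = esum_words P (fun=> 1) y.
Proof.
move=> + y0; rewrite /esum_words /iterint.
elim: P => [|w P ih /= [pw pP]]; first by rewrite !big_nil.
have g1 := good_cst _ ler01.
have w0 : 0 <= eword w (fun=> 1) y by have [_ ->] := eword_good _ _ pw g1.
have P0 : 0 <= esum_words P (fun=> 1) y by have [_ ->] := esum_words_good _ _ pP g1.
rewrite !big_cons => fin; have [|cw ew] := convergent_eword w y pw y0.
  by apply: le_lt_trans fin; rewrite leeDl.
have [//||cP eP] := ih; first by apply: le_lt_trans fin; rewrite leeDr.
by split=> //; rewrite EFinD ew eP.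
Qed.

End Steps.

(** * Parity and primitives *)

Section Parity.
Context {R : realType}.
Local Notation mu := (@lebesgue_measure R).

Lemma segment0_pos (y : R) : 0 < y -> segment0 y = `]0, y[%classic.
Proof.
by move=> y0; rewrite /segment0 (min_idPl (ltW y0)) (max_idPr (ltW y0)).
Qed.

Lemma segment0_neg (y : R) : 0 < y -> segment0 (- y) = `](- y), 0[%classic.
Proof.
move=> y0; have ny : - y <= 0 by rewrite oppr_le0 ltW.
by rewrite /segment0 (min_idPr ny) (max_idPl ny).
Qed.

Lemma integral_reflect (h : R -> R) (y : R) :
  mu.-integrable `]0, y[ (fun t => (h (- t))%:E) ->
  mu.-integrable `](- y), 0[ (fun t => (h t)%:E) /\
  (\int[mu]_(t in `](- y)%R, 0%R[) (h t)%:E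
   = \int[mu]_(t in `]0%R, y[) (h (- t)%R)%:E)%E.
Proof.
move=> /integrableP[mh hfin].
have pre : (-%R : R -> measurableTypeR R) @^-1` `](- y), 0[ = `]0, y[%classic.
  by apply/seteqP; split=> t /=; rewrite !in_itv/= oppr_lt0 ltrN2 andbC.
have mhn : measurable_fun `](- y), 0[ (fun t => (h t)%:E).
  rewrite (_ : (fun t => _) = (fun t => (h (- t))%:E) \o -%R); last first.
    by apply/funext => t /=; rewrite opprK.
  apply: (@measurable_comp _ _ _ _ _ _ `]0, y[%classic) => //.
  move=> _ [t /= + <-]; rewrite !in_itv/= oppr_gt0.
  by rewrite ltrNl andbC.
have eqm (g : R -> \bar R) : (\int[mu]_(t in `](- y)%R, 0%R[) g t
    = \int[pushforward mu (-%R : R -> measurableTypeR R)]_(t in `](- y)%R, 0%R[) g t)%E.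
  by apply: eq_measure_integral => //= S mS _; exact/esym/lebesgue_measureN.
(* The extension by 0 is measurable on the whole line, as the change of variables by pushforward
   demands. *)
pose F := (fun t => (h t)%:E) \_ `](- y), 0[.
have mF : measurable_fun setT F by exact/(measurable_restrictT _ _).1.
have intF : mu.-integrable ((-%R : R -> measurableTypeR R) @^-1` `](- y), 0[)
    (F \o -%R).
  rewrite pre; apply/integrableP; split.
    apply: eq_measurable_fun mh => t; rewrite inE/= in_itv/= => ty.
    by rewrite /F/= patchE mem_set//= in_itv/= oppr_lt0 ltrN2 andbC.
  apply: le_lt_trans hfin; rewrite le_eqVlt; apply/orP; left; apply/eqP.
  apply: eq_integral => t; rewrite inE/= in_itv/= => ty.
  by rewrite /F/= patchE mem_set//= in_itv/= oppr_lt0 ltrN2 andbC.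
split.
  apply/integrableP; split => //.
  apply: le_lt_trans hfin; rewrite eqm ge0_integral_pushforward//= ?pre//.
  apply/measurable_EFinP; apply: measurableT_comp => //.
  exact/measurable_EFinP.
transitivity (\int[mu]_(t in `](- y)%R, 0%R[) F t)%E.
  by apply: eq_integral => t ty; rewrite /F patchE ty.
rewrite eqm.
transitivity (\int[mu]_(t in (-%R : R -> measurableTypeR R) @^-1` `](- y)%R, 0%R[)
    (F \o -%R) t)%E; first by apply: integral_pushforward.
rewrite pre; apply: eq_integral => t; rewrite inE/= in_itv/= => ty.
by rewrite /F/= patchE mem_set//= in_itv/= oppr_lt0 ltrN2 andbC.
Qed.

(** The additional sign is the orientation [Num.sg]: integration from 0 exchanges even and odd
    functions. *)
Lemma integral_from0_reflect (h : R -> R) (b : bool) (y : R) : 0 < y ->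
  (forall t, 0 < t < y -> h (- t) = (-1) ^+ b * h t) ->
  mu.-integrable (segment0 y) (fun t => (h t)%:E) ->
  mu.-integrable (segment0 (- y)) (fun t => (h t)%:E) /\
  integral_from0 h (- y) = (-1) ^+ (~~ b) * integral_from0 h y.
Proof.
move=> y0 hb; rewrite (segment0_pos _ y0) => hint.
have hint' : mu.-integrable `]0, y[ (fun t => (h (- t))%:E).
  have m0 : measurable (`]0, y[%classic : set (measurableTypeR R)) by [].
  apply: eq_integrable (integrableZl m0 ((-1) ^+ b) hint) => // t.
  by rewrite inE/= in_itv/= => ty; rewrite hb// EFinM.
have [i1 i2] := integral_reflect h y hint'.
rewrite /integral_from0 (segment0_neg _ y0) (segment0_pos _ y0); split => //.
rewrite sgrN (gtr0_sg y0) mulN1r mul1r /Rintegral i2.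
have -> : (\int[mu]_(t in `]0%R, y[) (h (- t))%:E
    = ((-1) ^+ b)%:E * \int[mu]_(t in `]0%R, y[) (h t)%:E)%E.
  rewrite -integralZl//; apply: eq_integral => t.
  by rewrite inE/= in_itv/= => ty; rewrite hb// EFinM.
rewrite fineM//=; last exact: integrable_fin_num.
by case: (b); rewrite /= !(expr0, expr1) !(mul1r, mulN1r) ?opprK.
Qed.

Definition has_parity (b : bool) (f : R -> R) := forall t, f (- t) = (-1) ^+ b * f t.

(** With [true] for odd, multiplication by a letter adds parities and integration from 0 flips the
    result; the empty word is the constant 1, which is even. *)
Fixpoint word_parity (w : word R) (b : bool) : Prop :=
  if w is f :: w' then
    exists b1 b2, [/\ has_parity b1 f, word_parity w' b2 & b = ~~ (b1 (+) b2)]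
  else b = false.

Lemma word_reflect (w : word R) b (y : R) : 0 < y -> word_parity w b ->
  convergent_word w y ->
  convergent_word w (- y) /\ iterint_word w (- y) = (-1) ^+ b * iterint_word w y.
Proof.
elim: w b y => [|f w ih] b y y0 /=; first by move=> ->; rewrite expr0 mulr1.
move=> [b1 [b2 [pf pw ->]]] [hint hcv].
have hb t : 0 < t < y ->
   f (- t) * iterint_word w (- t) = (-1) ^+ (b1 (+) b2) * (f t * iterint_word w t).
  move=> /andP[t0 ty]; have st : segment0 y t.
    by rewrite (segment0_pos _ y0)/= in_itv/= t0 ty.
  by have [_ ->] := ih b2 t t0 pw (hcv t st); rewrite pf signr_addb mulrACA.
have [h1 h2] := integral_from0_reflect _ _ _ y0 hb hint.
split => //; split => // t; rewrite (segment0_neg _ y0)/= in_itv/= => /andP[yt t0].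
have nt0 : 0 < - t by rewrite oppr_gt0.
have st : segment0 y (- t).
  by rewrite (segment0_pos _ y0)/= in_itv/= oppr_gt0 t0 ltrNl.
by rewrite -[t]opprK; have [] := ih b2 _ nt0 pw (hcv _ st).
Qed.

Lemma fsum_reflect (P : fsum R) (y : R) : 0 < y ->
  all_words (word_parity ^~ true) P -> convergent P y ->
  convergent P (- y) /\ iterint P (- y) = - iterint P y.
Proof.
move=> y0; rewrite /iterint; elim: P => [|w P ih].
  by move=> _ _; rewrite !big_nil oppr0.
move=> /= [pw /ih{}ih] [cw /ih[cP eP]]; rewrite !big_cons.
have [cw' ew] := word_reflect w true y y0 pw cw.
by split => //; rewrite ew eP expr1 mulN1r opprD.
Qed.

Lemma word_at0 (w : word R) : convergent_word w 0.
Proof.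
case: w => //= f w; have -> : segment0 (0 : R) = set0.
  by rewrite /segment0 minxx maxxx set_itvoo0.
by split => //; exact: integrable_set0.
Qed.

Lemma convergent0 (P : fsum R) : convergent P 0.
Proof. by elim: P => //= w P ih; split => //; exact: word_at0. Qed.

Lemma integral_from00 (h : R -> R) : integral_from0 h 0 = 0.
Proof. by rewrite /integral_from0 sgr0 mul0r. Qed.

Lemma iterint0 (P : fsum R) : all_words (fun w => w <> [::]) P -> iterint P 0 = 0.
Proof.
rewrite /iterint; elim: P => [|w P ih /= [w0 /ih]]; first by rewrite big_nil.
by rewrite big_cons => ->; case: w w0 => // f w _; rewrite /= integral_from00 addr0.
Qed.

Lemma word_parity_neq0 w : word_parity w true -> w <> [::].
Proof. by case: w. Qed.

(** The base point is moved from 0 to some [a] below both 0 and [y]. Near [y] the oriented integral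
    is then [F z - F 0], whatever the sign of [z]. *)
Lemma is_derive_integral_from0 (q : R -> R) (y : R) : continuous q ->
  is_derive y 1 (integral_from0 q) (q y).
Proof.
move=> cq; pose a := Num.min 0 y - 1.
have a0 : a < 0 by rewrite /a ltrBlDr add0r gt_min ltr01.
have ay : a < y by rewrite /a ltrBlDr gt_min ltrDl ltr01 orbT.
have int (b c : itv_bound R) (u v : R) : (BLeft u <= b)%O -> (c <= BRight v)%O ->
    mu.-integrable [set` Interval b c] (EFin \o q).
  move=> ub cv; have : mu.-integrable `[u, v] (EFin \o q).
    apply: continuous_compact_integrable; first exact: segment_compact.
    exact: continuous_subspaceT.
  by apply: integrableS => //; apply: subset_itv.
pose F x := \int[mu]_(t in `[a, x]) q t.
have FE z : a < z -> integral_from0 q z = F z - F 0.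
  move=> az; rewrite /integral_from0; have [z0|z0|->] := ltgtP z 0.
  - have -> : segment0 z = `]z, 0[%classic.
      by rewrite /segment0 (min_idPr (ltW z0)) (max_idPl (ltW z0)).
    rewrite ltr0_sg// mulN1r -opprB; congr (- _).
    rewrite /F (@Rintegral_itvB _ q (BLeft a) (BRight 0) z)
      ?bnd_simp ?(ltW az) ?(ltW z0)//.
      by rewrite Rintegral_itv_bndo_bndc//; apply: (int _ _ z 0); rewrite ?bnd_simp.
    by apply: (int _ _ a 0); rewrite ?bnd_simp.
  - rewrite segment0_pos// gtr0_sg// mul1r.
    rewrite /F (@Rintegral_itvB _ q (BLeft a) (BRight z) 0)
      ?bnd_simp ?(ltW a0) ?(ltW z0)//.
      by rewrite Rintegral_itv_bndo_bndc//; apply: (int _ _ 0 z); rewrite ?bnd_simp.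
    by apply: (int _ _ a z); rewrite ?bnd_simp.
  - by rewrite sgr0 mul0r subrr.
have [dF F'] : derivable F y 1 /\ derive1 F y = q y.
  (* The right end [y + 1] only serves to make [y] an interior point. *)
  apply: (@continuous_FTC1_closed _ q a y (y + 1)) => //; first by rewrite ltrDl.
    by apply: (int _ _ a (y + 1)); rewrite ?bnd_simp.
  exact: cq.
apply: (@near_eq_is_derive _ _ _ (fun z => F z - F 0)).
  near=> z; rewrite FE//; near: z; exact: lt_nbhsr.
have dFy : is_derive y 1 F (q y).
  by rewrite -F' derive1E; exact: derivableP.
rewrite -[q y]subr0.
exact: (is_deriveB dFy (is_derive_cst (F 0) y 1)).
Unshelve. all: by end_near. Qed.

End Parity.

(** * Forms on a parametrized circle arc *)

Section CircleParametrization.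
Context {R : realType}.
(** The point [(sg, cg)] moves on the unit circle with speed [rho]. The differential hypotheses stay
    on the open interval: in the algebraic instance [cg] is not differentiable at [A = 1]. *)
Variables (A : R) (sg cg rho : R -> R).
Hypothesis A_gt0 : 0 < A.
Hypothesis dsg : forall t, - A < t < A -> is_derive t 1 sg (cg t * rho t).
Hypothesis dcg : forall t, - A < t < A -> is_derive t 1 cg (- (sg t * rho t)).
Hypothesis crho : forall t, - A < t < A -> {for t, continuous rho}.
Hypothesis circle : forall t, - A < t < A -> sg t ^+ 2 + cg t ^+ 2 = 1.
Hypothesis sg0 : sg 0 = 0.
Hypothesis sgA_ge0 : 0 <= sg A.
Hypothesis sg_gt0 : forall t, 0 < t < A -> 0 < sg t.
Hypothesis cg_gt0 : forall t, - A < t < A -> 0 < cg t.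
Hypothesis rho_gt0 : forall t, - A < t < A -> 0 < rho t.

Local Notation mu := (@lebesgue_measure R).

Lemma half_dom (t : R) : 0 < t < A -> - A < t < A.
Proof. by move=> /andP[t0 ->]; rewrite (lt_trans _ t0)// oppr_lt0. Qed.

Lemma is_derive_continuous (f : R -> R) (t d : R) :
  is_derive t 1 f d -> {for t, continuous f}.
Proof.
by move=> df; apply: differentiable_continuous; apply/derivable1_diffP/ex_derive.
Qed.

Lemma csg (t : R) : - A < t < A -> {for t, continuous sg}.
Proof. by move/dsg/is_derive_continuous. Qed.

Lemma ccg (t : R) : - A < t < A -> {for t, continuous cg}.
Proof. by move/dcg/is_derive_continuous. Qed.

Lemma continuousX (f : R -> R) (t : R) k : {for t, continuous f} ->
  {for t, continuous (fun x => f x ^+ k)}.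
Proof.
move=> cf; apply: (@continuous_comp _ _ _ f (fun z => z ^+ k)) => //.
exact: exprn_continuous.
Qed.

Lemma is_derive_sgX (t : R) k : - A < t < A ->
  is_derive t 1 (fun x => sg x ^+ k) (k%:R * sg t ^+ k.-1 * (cg t * rho t)).
Proof.
move=> tA; rewrite (_ : (fun x => _) = sg ^+ k); last first.
  by apply/funext => x; rewrite exprfctE.
exact: (is_deriveX k (dsg t tA)).
Qed.

Lemma measurable_half (f : R -> R) :
  (forall t, 0 < t < A -> {for t, continuous f}) -> measurable_fun `]0, A[ f.
Proof.
move=> cf; apply: subspace_continuous_measurable_fun => //.
apply: continuous_in_subspaceT => t; rewrite inE/= in_itv/=; exact: cf.
Qed.

Lemma FTC_half (F f : R -> R) (y : R) : 0 < y < A ->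
  (forall t, - A < t < A -> is_derive t 1 F (f t)) ->
  (forall t, - A < t < A -> {for t, continuous f}) ->
  mu.-integrable `]0, y[ (fun t => (f t)%:E) /\
  (\int[mu]_(t in `]0%R, y[) (f t)%:E = (F y - F 0)%:E)%E.
Proof.
move=> /andP[y0 yA] dF cf.
have dom t : 0 <= t <= y -> - A < t < A.
  move=> /andP[t0 ty]; rewrite (lt_le_trans _ t0) ?oppr_lt0//=.
  exact: le_lt_trans yA.
have cw : {within `[0, y], continuous f}.
  apply: continuous_in_subspaceT => t; rewrite inE/= in_itv/= => /dom; exact: cf.
have cF t : 0 <= t <= y -> {for t, continuous F}.
  by move=> /dom/dF/is_derive_continuous.
have int : mu.-integrable `[0, y] (fun t => (f t)%:E).
  by apply: continuous_compact_integrable => //; exact: segment_compact.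
have into : mu.-integrable `]0, y[ (fun t => (f t)%:E).
  by apply: integrableS int => //; exact: subset_itv_oo_cc.
split => //.
rewrite -(@integral_itv_bndoo _ _ _ _ true false); last first.
  by move/integrableP : into => [].
rewrite (@continuous_FTC2 _ f F)//; first split.
- move=> t; rewrite in_itv/= => /andP[t0 ty].
  by apply: (@ex_derive _ _ _ _ _ _ _ (dF t (dom t _))); rewrite !ltW.
- by apply: cvg_at_right_filter; apply: cF; rewrite lexx ltW.
- by apply: cvg_at_left_filter; apply: cF; rewrite lexx ltW.
- move=> t; rewrite in_itv/= => /andP[t0 ty]; rewrite derive1E.
  by apply: (@derive_val _ _ _ _ _ _ _ (dF t (dom t _))); rewrite !ltW.
Qed.

(** The form [rho cg dt] is the differential of [sg]. *)
Lemma int_monomial (j : nat) (y : R) : 0 < y < A ->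
  estep (fun t => rho t * cg t) (fun t => (sg t ^+ j)%:E) y
  = (sg y ^+ j.+1 / j.+1%:R)%:E.
Proof.
move=> yA; pose F t := j.+1%:R^-1 * sg t ^+ j.+1.
have [|t tA|_ E] := FTC_half F (fun t => rho t * cg t * sg t ^+ j) y yA.
- move=> t tA.
  apply: (is_derive_eq (is_deriveZ (j.+1%:R^-1) (is_derive_sgX t j.+1 tA))).
  by rewrite /GRing.scale/= !mulrA mulVf ?pnatr_eq0// mul1r; ring.
- apply: (@continuousM _ _ (fun t => rho t * cg t) (fun t => sg t ^+ j)).
    by apply: (@continuousM _ _ rho cg); [exact: crho|exact: ccg].
  by apply: continuousX; exact: csg.
- rewrite /estep -[RHS]/((_)%:E) (_ : sg y ^+ j.+1 / j.+1%:R = F y - F 0).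
    by rewrite -E; apply: eq_integral => t _; rewrite EFinM.
  by rewrite /F sg0 expr0n mulr0 subr0 mulrC.
Qed.

Lemma bfun_ge0 n (x : R) : 0 <= bfun n x.
Proof.
by rewrite mulr_ge0 ?(ltW (acoef_gt0 n))// mul2n -addnn exprD sqr_ge0.
Qed.

Lemma good_comp_sg (g : R -> R) : continuous g -> (forall x, 0 <= g x) ->
  good A (fun t => (g (sg t))%:E).
Proof.
move=> cgg g0; split; last by move=> t _; rewrite lee_fin.
apply/measurable_EFinP; apply: measurable_half => t /half_dom tA.
by apply: (@continuous_comp _ _ _ sg g); [exact: csg|exact: cgg].
Qed.

Lemma bfun_continuous n : continuous (bfun n : R -> R).
Proof. by move=> x; apply: cvgMr; exact: exprn_continuous. Qed.

Lemma good_bfun n : good A (fun t => (bfun n (sg t))%:E).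
Proof. by apply: good_comp_sg; [exact: bfun_continuous|exact: bfun_ge0]. Qed.

Lemma pos_rho : pos_form A rho.
Proof.
split; last by move=> t /half_dom/rho_gt0.
by apply: measurable_half => t /half_dom/crho.
Qed.

Lemma pos_rho_cg : pos_form A (fun t => rho t * cg t).
Proof.
split; last by move=> t /half_dom tA; rewrite mulr_gt0 ?rho_gt0 ?cg_gt0.
apply: measurable_half => t /half_dom tA.
by apply: (@continuousM _ _ rho cg); [exact: crho|exact: ccg].
Qed.

(** * The innermost integral and its expansion in powers of the sine *)

Definition beta (n : nat) := estep rho (fun t => (bfun n (sg t))%:E).

Lemma good_beta n : good A (beta n).
Proof. exact: estep_good pos_rho (good_bfun n). Qed.

Lemma sg_lt1 (t : R) : 0 < t < A -> 0 <= sg t < 1.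
Proof.
move=> tA; have s0 := sg_gt0 t tA; rewrite ltW//=.
have := circle t (half_dom t tA); have := cg_gt0 t (half_dom t tA); nra.
Qed.

(** By [int_monomial] with [j = 0], [sg] is itself the integral of a positive form. *)
Lemma sg_nd (s t : R) : 0 < s -> s <= t -> t < A -> sg s <= sg t.
Proof.
move=> s0 st tA.
have g1 : good A (fun t => (sg t ^+ 0)%:E).
  apply: (good_comp_sg (fun x => x ^+ 0)) => [|x]; last by rewrite expr0.
  exact: exprn_continuous.
have := estep_nd A _ _ s t pos_rho_cg g1 st (ltW tA).
have sA : 0 < s < A by rewrite s0 (le_lt_trans st).
have tA' : 0 < t < A by rewrite tA (lt_le_trans s0).
rewrite (int_monomial 0 s sA) (int_monomial 0 t tA') !expr1 !divr1 lee_fin.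
exact.
Qed.

Lemma cbeta_integrand n (t : R) : - A < t < A ->
  {for t, continuous (fun t => rho t * bfun n (sg t))}.
Proof.
move=> tA; apply: (@continuousM _ _ rho (fun t => bfun n (sg t))).
  exact: crho.
apply: (@continuous_comp _ _ _ sg (bfun n)); first exact: csg.
exact: bfun_continuous.
Qed.

Lemma beta_int n (y : R) : 0 < y < A ->
  mu.-integrable `]0, y[ (fun t => (rho t * bfun n (sg t))%:E).
Proof.
move=> /andP[y0 yA].
have : mu.-integrable `[0, y] (fun t => (rho t * bfun n (sg t))%:E).
  apply: continuous_compact_integrable; first exact: segment_compact.
  apply: continuous_in_subspaceT => t; rewrite inE/= in_itv/= => /andP[t0 ty].
  apply: cbeta_integrand; rewrite (lt_le_trans _ t0) ?oppr_lt0//=.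
  exact: le_lt_trans yA.
by apply: integrableS => //; exact: subset_itv_oo_cc.
Qed.

Lemma betaE n (y : R) : 0 < y < A ->
  (beta n y = \int[mu]_(t in `]0%R, y[) (rho t * bfun n (sg t))%:E)%E.
Proof. by move=> yA; apply: eq_integral => t _; rewrite EFinM. Qed.

Lemma beta_fin n (y : R) : 0 < y < A -> beta n y \is a fin_num.
Proof.
by move=> yA; rewrite betaE//; apply: integrable_fin_num => //; exact: beta_int.
Qed.

(* [cg sg^(2m+1) a_(m+1) / (2m+2)] is a primitive of the difference of the
   integrands, by [sg^2 + cg^2 = 1] and the recurrence of [acoef]. *)
Lemma beta_rec m (y : R) : 0 < y < A ->
  fine (beta m y) = fine (beta m.+1 y)
     + cg y / sg y * (bfun m.+1 (sg y) / (2 * m.+1%:R)).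
Proof.
move=> yA; have y0 := sg_gt0 y yA.
pose k : R := acoef m.+1 / (2 * m.+1%:R).
pose F t := k * (cg t * sg t ^+ (2 * m).+1).
have m0 : 0 <= m%:R :> R by [].
have [|t tA|_ E] := FTC_half F
  (fun t => rho t * bfun m (sg t) - rho t * bfun m.+1 (sg t)) y yA.
- move=> t tA.
  apply: (is_derive_eq (is_deriveZ k
    (is_deriveM (dcg t tA) (is_derive_sgX t (2 * m).+1 tA)))).
  have e2 := circle t tA.
  rewrite /GRing.scale/= /bfun -/(acoef m) -/(acoef m.+1).
  have -> : acoef m = (2 * m%:R + 1) * k.
    have := acoef_div (R:=R) m; rewrite -/k => <-.
    by rewrite mulrC divfK//; lra.
  have -> : acoef m.+1 = (2 * m%:R + 2) * k.
    by rewrite /k -natr1; field; lra.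
  rewrite mulnS !exprS -natr1 natrM; move: (sg t ^+ (2 * m)) => p.
  have e3 : cg t * cg t = 1 - sg t * sg t by rewrite -!expr2 -e2 addrC addKr.
  transitivity (k * rho t * p * ((2 * m%:R + 1) * (cg t * cg t) - sg t * sg t)).
    ring.
  by rewrite e3; ring.
- apply: (@continuousB _ _ _ (fun t => rho t * bfun m (sg t))
    (fun t => rho t * bfun m.+1 (sg t))); exact: cbeta_integrand.
- have i1 := beta_int m y yA; have i2 := beta_int m.+1 y yA.
  move: E; rewrite (_ : (fun t => _) = (fun t =>
     (rho t * bfun m (sg t))%:E - (rho t * bfun m.+1 (sg t))%:E)%E)//.
  rewrite integralB_EFin// -!betaE// -(fineK (beta_fin m y yA)).
  rewrite -(fineK (beta_fin m.+1 y yA)) -EFinB => -[] /eqP.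
  rewrite subr_eq => /eqP ->; rewrite addrC; congr (_ + _).
  rewrite /F sg0 expr0n/= !mulr0 subr0 /k /bfun -/(acoef m.+1).
  by rewrite mulnS !exprS; field; rewrite !lt0r_neq0//= pnatr_eq0.
Qed.

Lemma bfun0 (x : R) : bfun 0 x = 1.
Proof. by rewrite /bfun muln0 !expr0 bin0 invr1 !mulr1. Qed.

(** Monotonicity of [sg] gives [beta_m(y) <= b_m(sg y) beta_0(y)], and [b_m(sg y)] tends to 0. This
    removes the remainder of the telescoping sum. *)
Lemma beta_cvg0 (y : R) : 0 < y < A -> fine (beta m y) @[m --> \oo] --> 0.
Proof.
move=> yA; have /andP[y0 y1] := yA.
have cb : bfun m (sg y) * fine (beta 0 y) @[m --> \oo] --> 0.
  rewrite -[X in _ --> X](mul0r (fine (beta 0 y))); apply: cvgMl.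
  exact/bfun_cvg0/sg_lt1.
apply: (squeeze_cvgr _ (cvg_cst 0) cb); apply: nearW => m.
apply/andP; split.
  by apply: fine_ge0; have [_ ->] := good_beta m; rewrite ?y0 ?ltW.
rewrite -lee_fin EFinM !fineK ?beta_fin//.
rewrite -(estepZ A)//; [|exact: pos_rho|exact: good_bfun|exact: bfun_ge0|exact: ltW].
have [m1 p1] := good_integrand _ _ _ _ pos_rho (good_bfun m) (ltW y1).
have [m2 p2] := good_integrand _ _ _ _ pos_rho
  (goodZ _ _ _ (bfun_ge0 m (sg y)) (good_bfun 0)) (ltW y1).
apply: ge0_le_integral => // t; rewrite /= in_itv/= => /andP[t0 ty].
rewrite bfun0 mule1 lee_wpmul2l// lee_fin.
  by rewrite ltW// rho_gt0// half_dom// t0 (lt_trans ty).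
have tA : 0 < t < A by rewrite t0 (lt_trans ty).
have st := sg_nd t y t0 (ltW ty) y1.
rewrite ler_wpM2l ?(ltW (acoef_gt0 m))// lerXn2r// nnegrE ltW ?sg_gt0//.
Qed.

Lemma beta_series n (t : R) : 0 < t < A ->
  (beta n t = (cg t / sg t)%:E
     * \sum_(m <oo) (step_coef L2m 1 n m * bfun m (sg t))%:E)%E.
Proof.
move=> tA; have s0 := sg_gt0 t tA; have c0 := cg_gt0 t (half_dom t tA).
(* Terms with [m <= n] vanish, so [N] counts the nonzero terms, from [n + 1] to [n + N]. *)
have part N : \sum_(0 <= m < N + n.+1) step_coef L2m 1 n m * bfun m (sg t)
    = sg t / cg t * (fine (beta n t) - fine (beta (N + n) t)).
  elim: N => [|N ih].
    rewrite !add0n subrr mulr0 big_nat big1// => m /andP[_ mn].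
    by rewrite /step_coef/= ltnNge -ltnS mn mul0r.
  rewrite addSn big_nat_recr//= ih addnS addSn (beta_rec (N + n) t tA).
  rewrite /step_coef/= ltnS leq_addl expr1.
  by field; rewrite !lt0r_neq0//= pnatr_eq0.
have -> : (\sum_(m <oo) (step_coef L2m 1 n m * bfun m (sg t))%:E
    = (sg t / cg t * (fine (beta n t)))%:E)%E.
  apply/cvg_lim => //; rewrite -(cvg_shiftn n.+1)/=.
  under eq_fun do rewrite sumEFin part.
  apply: cvg_EFin; first exact: nearW.
  apply: cvgMr; rewrite -[X in _ --> X]subr0; apply: cvgB; first exact: cvg_cst.
  by rewrite (cvg_shiftn n (fun m => fine (beta m t))); exact: beta_cvg0.
rewrite -EFinM mulrA.
have -> : cg t / sg t * (sg t / cg t) = 1 by field; rewrite !lt0r_neq0.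
by rewrite mul1r fineK// beta_fin.
Qed.

(** * Termwise action of the letters and blocks *)

Lemma scale_series (x : R) (u : nat -> R) : (forall m, 0 <= u m) ->
  (x%:E * \sum_(m <oo) (u m)%:E = \sum_(m <oo) (x * u m)%:E)%E.
Proof. by move=> u0; rewrite -nneseriesZl// => m _; rewrite lee_fin. Qed.

(** By [acoef_div], [b_(m+1)(x) / (2m+2) = x^2 b_m(x) / (2m+1)]. The reindexing turns [m + 1 > n]
    into [m >= n], which is why [2m+1] comes with the weak relation. *)
Lemma beta_series_shift n (x : R) :
  (\sum_(m <oo) (step_coef L2m 1 n m * bfun m x)%:E
   = (x ^+ 2)%:E * \sum_(m <oo) (step_coef L2mp1 1 n m * bfun m x)%:E)%E.
Proof.
have nn l m : 0 <= step_coef l 1 n m * bfun m x.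
  by rewrite mulr_ge0 ?step_coef_ge0 ?bfun_ge0.
rewrite nneseries_recl//; last by move=> k _; rewrite lee_fin.
rewrite {1}/step_coef/= mul0r add0e -nneseries_addn; last first.
  by move=> k; rewrite lee_fin.
rewrite scale_series//; apply: eq_eseriesr => m _; congr EFin.
rewrite addn1 /step_coef/= ltnS; case: ifPn => _; last by rewrite !mul0r mulr0.
rewrite /bfun -/(acoef m.+1) -/(acoef m) !expr1.
have m0 : 0 <= m%:R :> R by [].
have -> : acoef m.+1 = 2 * m.+1%:R * (acoef m / (2 * m%:R + 1)) :> R.
  by rewrite acoef_div mulrC divfK// mulf_neq0 ?pnatr_eq0.
by rewrite mulnS exprD -natr1; field; rewrite !lt0r_neq0//; lra.
Qed.

(** The vanishing of [c m] at [e m = 0] neutralizes both the truncated [(e m).-1] and the division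
    by 0. *)
Lemma estep_primitive (c : nat -> R) (e : nat -> nat) f phi (y : R) :
  (forall m, 0 <= c m) -> (forall m, e m = 0%N -> c m = 0) ->
  (forall t, (0 < t < A)%R -> (f t)%:E * phi t
    = (rho t * cg t)%:E * \sum_(m <oo) (c m * sg t ^+ (e m).-1)%:E)%E ->
  0 < y < A ->
  (estep f phi y = \sum_(m <oo) (c m / (e m)%:R * sg y ^+ e m)%:E)%E.
Proof.
move=> c0 ce fphi yA; have /andP[y0 yA'] := yA.
have gX k : good A (fun t => (sg t ^+ k)%:E).
  split.
    apply/measurable_EFinP; apply: measurable_half => t /half_dom tA.
    by apply: continuousX; exact: csg.
  move=> t /andP[t0]; rewrite le_eqVlt lee_fin => /predU1P[->|tA].
    by rewrite exprn_ge0.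
  by rewrite exprn_ge0// ltW// sg_gt0// t0.
rewrite (eq_estep A _ _ _ _ _ (ltW yA') fphi) (estep_series A).
- apply: eq_eseriesr => m _.
  have [em|em] := posnP (e m).
    rewrite (ce _ em) !mul0r /estep integral0_eq// => t _.
    by rewrite mul0r mule0.
  transitivity ((c m)%:E * estep (fun t => (rho t * cg t)%R)
      (fun t => (sg t ^+ (e m).-1)%:E) y)%E.
    by rewrite -(estepZ A)//; [exact: pos_rho_cg|exact: ltW].
  by rewrite int_monomial// -EFinM prednK// mulrA mulrAC.
- exact: pos_rho_cg.
- move=> m; have := goodZ A _ _ (c0 m) (gX (e m).-1).
  by congr good; apply/funext => t; rewrite EFinM.
- exact: ltW.
Qed.

(** Closes a block: once its first letter has restored the factors [rho b_m], the outer integration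
    produces the [beta_m] again, ready for the next block. *)
Lemma estep_beta (c : nat -> R) f phi (y : R) : (forall m, 0 <= c m) ->
  (forall t, (0 < t < A)%R -> (f t)%:E * phi t
    = (rho t)%:E * \sum_(m <oo) (c m * bfun m (sg t))%:E)%E ->
  y <= A -> (estep f phi y = \sum_(m <oo) (c m)%:E * beta m y)%E.
Proof.
move=> c0 fphi yA; rewrite (eq_estep A _ _ _ _ _ yA fphi).
rewrite (estep_series A) //; [|exact: pos_rho|].
  apply: eq_eseriesr => m _.
  by rewrite -(estepZ A)//; [exact: pos_rho|exact: good_bfun].
move=> m; have := goodZ A _ _ (c0 m) (good_bfun m).
by congr good; apply/funext => t; rewrite EFinM.
Qed.

(* [hform] is [2 csc 2t dt] in the trigonometric case, but the formal sum of two
   words [omega0 + omega2] in the algebraic one. *)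
Variables (fcot fcsc fsin ftan : R -> R) (hform : fsum R).
Hypothesis fcotE : forall t, 0 < t < A -> fcot t = rho t * (cg t / sg t).
Hypothesis fcscE : forall t, 0 < t < A -> fcsc t = rho t / sg t.
Hypothesis fsinE : forall t, 0 < t < A -> fsin t = rho t * sg t.
Hypothesis ftanE : forall t, 0 < t < A -> ftan t = rho t * (sg t / cg t).
Hypothesis hformE : forall phi y, good A phi -> 0 < y <= A ->
  esum_words hform phi y = estep (fun t => rho t / (sg t * cg t)) phi y.

Lemma iter_cot (c : nat -> R) (e : nat -> nat) phi k (t : R) :
  (forall m, 0 <= c m) -> (forall m, e m = 0%N -> c m = 0) ->
  (forall t, (0 < t < A)%R ->
     phi t = \sum_(m <oo) (c m * sg t ^+ e m)%:E)%E ->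
  0 < t < A ->
  (iter k (estep fcot) phi t
    = \sum_(m <oo) (c m / (e m)%:R ^+ k * sg t ^+ e m)%:E)%E.
Proof.
move=> c0 ce phiE; elim: k t => [|k ih] t tA /=.
  by rewrite phiE//; apply: eq_eseriesr => m _; rewrite expr0 divr1.
rewrite (estep_primitive (fun m => c m / (e m)%:R ^+ k) e)//.
- by apply: eq_eseriesr => m _; rewrite exprSr invfM mulrA.
- by move=> m; rewrite divr_ge0.
- by move=> m /ce ->; rewrite mul0r.
- move=> u uA; have s0 := sg_gt0 u uA; rewrite ih// fcotE//.
  have ck m : 0 <= c m / (e m)%:R ^+ k by rewrite divr_ge0.
  rewrite !scale_series; last 2 first.
  + by move=> m; rewrite mulr_ge0// exprn_ge0// ltW.
  + by move=> m; rewrite mulr_ge0// exprn_ge0// ltW.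
  apply: eq_eseriesr => m _; congr EFin.
  have [em|em] := posnP (e m); first by rewrite (ce _ em) !mul0r !mulr0.
  have -> : sg u ^+ e m = sg u * sg u ^+ (e m).-1 by rewrite -exprS prednK.
  by move: (c m / _) => q; field; rewrite lt0r_neq0.
Qed.

Lemma eword_cot k f phi (t : R) :
  eword (nseq k fcot ++ [:: f]) phi t = iter k (estep fcot) (estep f phi) t.
Proof.
by rewrite /eword foldr_cat/=; elim: k t => //= k ih t; congr estep; apply/funext.
Qed.

(** The factor [cg / sg] of [beta_series] lowers [sg^(2m)] to [cg sg^(2m-1)]; integration gives a
    second factor [1 / (2m)]. *)
Lemma dt_beta n (t : R) : 0 < t < A ->
  (estep rho (beta n) t
   = \sum_(m <oo) (step_coef L2m 2 n m * acoef m * sg t ^+ (2 * m))%:E)%E.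
Proof.
move=> tA; rewrite (estep_primitive (fun m => step_coef L2m 1 n m * acoef m)
   (fun m => 2 * m)%N) => //.
- apply: eq_eseriesr => m _; congr (_ * _)%:E; rewrite /step_coef/=.
  case: ifPn => nm; last by rewrite !mul0r.
  by rewrite natrM expr1 -exprVn; ring.
- by move=> m; rewrite mulr_ge0 ?step_coef_ge0// ltW// acoef_gt0.
- by case=> // _; rewrite /step_coef/= mul0r.
- move=> u uA; have s0 := sg_gt0 u uA.
  rewrite beta_series// muleA -EFinM !scale_series; last 2 first.
  + move=> m; rewrite !mulr_ge0 ?step_coef_ge0 ?(ltW (acoef_gt0 _))//.
    by rewrite exprn_ge0// ltW.
  + by move=> m; rewrite mulr_ge0 ?step_coef_ge0 ?bfun_ge0.
  apply: eq_eseriesr => -[|m] _; congr EFin.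
    by rewrite /step_coef/= !mul0r !mulr0.
  rewrite /bfun -/(acoef m.+1) mulnS /= exprS.
  by field; rewrite lt0r_neq0.
Qed.

Lemma csc_beta_minus n (t : R) : 0 < t < A ->
  (estep fcsc (beta n) t
   = \sum_(m <oo) (step_coef L2m 1 n m * acoef m / ((2 * m).-1)%:R
        * sg t ^+ (2 * m).-1)%:E)%E.
Proof.
move=> tA; rewrite (estep_primitive (fun m => step_coef L2m 1 n m * acoef m)
   (fun m => (2 * m).-1)%N) => //.
- by move=> m; rewrite mulr_ge0 ?step_coef_ge0// ltW// acoef_gt0.
- by case=> [_|m]; [rewrite /step_coef/= mul0r|rewrite mulnS].
- move=> u uA; have s0 := sg_gt0 u uA.
  rewrite beta_series// fcscE// muleA -EFinM !scale_series; last 2 first.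
  + move=> m; rewrite !mulr_ge0 ?step_coef_ge0 ?(ltW (acoef_gt0 _))//.
    by rewrite exprn_ge0// ltW.
  + by move=> m; rewrite mulr_ge0 ?step_coef_ge0 ?bfun_ge0.
  apply: eq_eseriesr => -[|m] _; congr EFin.
    by rewrite /step_coef/= !mul0r !mulr0.
  rewrite /bfun -/(acoef m.+1) mulnS /= !exprS.
  by field; rewrite lt0r_neq0.
Qed.

(** The same function as in [csc_beta_minus], expanded after [beta_series_shift]. The exponent
    [2m+1] suits a first letter [csc], the exponent [2m-1] a first letter [sin]: either restores
    [sg^(2m)]. *)
Lemma csc_beta_plus n (t : R) : 0 < t < A ->
  (estep fcsc (beta n) t
   = \sum_(m <oo) (step_coef L2mp1 2 n m * acoef m * sg t ^+ (2 * m).+1)%:E)%E.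
Proof.
move=> tA; rewrite (estep_primitive (fun m => step_coef L2mp1 1 n m * acoef m)
   (fun m => (2 * m).+1)%N) => //.
- apply: eq_eseriesr => m _; congr (_ * _)%:E; rewrite /step_coef/=.
  case: ifPn => nm; last by rewrite !mul0r.
  by rewrite -[(2 * m).+1%:R]natr1 natrM expr1 -exprVn; ring.
- by move=> m; rewrite mulr_ge0 ?step_coef_ge0// ltW// acoef_gt0.
- move=> u uA; have s0 := sg_gt0 u uA.
  rewrite beta_series// beta_series_shift fcscE// !muleA -!EFinM.
  rewrite !scale_series; last 2 first.
  + move=> m; rewrite !mulr_ge0 ?step_coef_ge0 ?(ltW (acoef_gt0 _))//.
    by rewrite exprn_ge0// ltW.
  + by move=> m; rewrite mulr_ge0 ?step_coef_ge0 ?bfun_ge0.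
  apply: eq_eseriesr => m _; congr EFin.
  by rewrite /bfun -/(acoef m)/=; field; rewrite lt0r_neq0.
Qed.

(** The blocks with all compositions expanded. The factor [cot dt + 1] yields the two words with
    [k + 1] and [k] letters [fcot]. *)
Definition gen_form (l : lfun) (s : nat) : fsum R :=
  match l with
  | L2m => if s is k.+2 then [:: rho :: nseq k fcot ++ [:: rho]]
           else [:: [:: ftan]]
  | L2mp1 => if s is k.+2 then [:: fcsc :: nseq k fcot ++ [:: fcsc]] else hform
  | L2mm1 =>
      if s is k.+2 then
        [:: fsin :: nseq k.+1 fcot ++ [:: fcsc]; fsin :: nseq k fcot ++ [:: fcsc]]
      else [:: [:: fsin; fcsc]; [:: ftan]]
  end.

Lemma ftan_beta n (y : R) : y <= A ->
  (estep ftan (beta n) y = \sum_(m <oo) (step_coef L2m 1 n m)%:E * beta m y)%E.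
Proof.
move=> yA; apply: estep_beta => // [m|t tA]; first exact: step_coef_ge0.
have s0 := sg_gt0 t tA; have c0 := cg_gt0 t (half_dom t tA).
rewrite beta_series// ftanE// muleA -EFinM; congr (_%:E * _)%E.
by field; rewrite !lt0r_neq0.
Qed.

Lemma sin_cot_beta n k (y : R) : y <= A ->
  (eword (fsin :: nseq k fcot ++ [:: fcsc]) (beta n) y
   = \sum_(m <oo) (step_coef L2m 1 n m / ((2 * m).-1)%:R ^+ k.+1)%:E * beta m y)%E.
Proof.
move=> yA /=; have cc m : 0 <= step_coef (R:=R) L2m 1 n m / ((2 * m).-1)%:R ^+ k.+1.
  by rewrite divr_ge0 ?step_coef_ge0.
have ca m : 0 <= step_coef (R:=R) L2m 1 n m * acoef m / ((2 * m).-1)%:R.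
  by rewrite divr_ge0// mulr_ge0 ?step_coef_ge0// ltW// acoef_gt0.
apply: estep_beta => // t tA; have s0 := sg_gt0 t tA.
rewrite -/(eword _ _) eword_cot.
rewrite (@iter_cot _ (fun m => (2 * m).-1) _ _ _ ca _ (csc_beta_minus n))//;
  last first.
  by case=> [_|m]; [rewrite /step_coef/= !mul0r|rewrite mulnS].
rewrite fsinE// !scale_series; last 2 first.
- by move=> m; apply: mulr_ge0; rewrite ?cc ?bfun_ge0.
- by move=> m; apply: mulr_ge0; [rewrite divr_ge0|rewrite exprn_ge0// ltW].
apply: eq_eseriesr => -[|m] _; congr EFin.
  by rewrite /step_coef/= !mul0r !mulr0.
rewrite /bfun -/(acoef m.+1) exprS invfM.
rewrite [in RHS](_ : (2 * m.+1) = ((2 * m.+1).-1).+1)%N; last by rewrite mulnS.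
rewrite exprS; move: (_.-1%:R)^-1 (_ ^- k) => p q /=; ring.
Qed.

(** Partial fractions: [1 + (2m-1) = 2m] cancels the factor [1 / (2m)] left by [beta_series]. This
    is the reason for the summand 1 in [cot dt + 1] and for the summand [tan dt] when [s = 1]. *)
Lemma step_coef_minus n m j :
  step_coef L2m 1 n m / ((2 * m).-1)%:R ^+ j.+1
  + step_coef L2m 1 n m / ((2 * m).-1)%:R ^+ j = step_coef L2mm1 j.+1 n m :> R.
Proof.
rewrite /step_coef/=; case: m => [|m]; first by rewrite ltn0 !mul0r addr0.
case: ifPn => _; last by rewrite !mul0r addr0.
have m0 : 0 <= m%:R :> R by [].
have e : (2 * m.+1).-1%:R = 2 * m%:R + 1 :> R.
  rewrite (_ : (2 * m.+1).-1 = (2 * m).+1)%N; last by rewrite mulnS.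
  by rewrite -[(2 * m).+1%:R]natr1 natrM.
rewrite e expr1 -[m.+1%:R]natr1.
have -> : 2 * (m%:R + 1) - 1 = 2 * m%:R + 1 :> R by ring.
rewrite exprS; field; rewrite ?expf_neq0//; apply/andP; split; lra.
Qed.

Lemma beta_ge0 n (y : R) : 0 < y <= A -> (0 <= beta n y)%E.
Proof. by move=> yA; have [_ ->] := good_beta n. Qed.

Lemma gen_form_beta l s n (y : R) : (0 < s)%N -> 0 < y <= A ->
  (esum_words (gen_form l s) (beta n) y
   = \sum_(m <oo) (step_coef l s n m)%:E * beta m y)%E.
Proof.
move=> s_gt0 yA; have /andP[y0 yA'] := yA.
have sum_minus j :
  (\sum_(m <oo) (step_coef L2m 1 n m / ((2 * m).-1)%:R ^+ j.+1)%:E * beta m y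
  + \sum_(m <oo) (step_coef L2m 1 n m / ((2 * m).-1)%:R ^+ j)%:E * beta m y
  = \sum_(m <oo) (step_coef L2mm1 j.+1 n m)%:E * beta m y)%E.
  have nn i m : 0 <= step_coef (R:=R) L2m 1 n m / ((2 * m).-1)%:R ^+ i.
    by rewrite divr_ge0 ?step_coef_ge0.
  rewrite -nneseriesD; last 2 first.
  - by move=> m _; rewrite mule_ge0 ?lee_fin ?nn ?beta_ge0.
  - by move=> m _; rewrite mule_ge0 ?lee_fin ?nn ?beta_ge0.
  apply: eq_eseriesr => m _; rewrite -ge0_muleDl ?lee_fin ?nn//.
  by rewrite -EFinD step_coef_minus.
case: l; case: s s_gt0 => [//|[|k]] _.
- by rewrite /esum_words big_seq1/=; exact: ftan_beta.
- rewrite /esum_words big_seq1/=; apply: estep_beta => // [m|t tA].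
    exact: step_coef_ge0.
  rewrite -/(eword _ _) eword_cot.
  rewrite (@iter_cot _ (fun m => 2 * m)%N _ _ _ _ _ (dt_beta n))//; last 2 first.
  + by move=> m; rewrite mulr_ge0 ?step_coef_ge0// ltW// acoef_gt0.
  + by case=> // _; rewrite /step_coef/= mul0r.
  congr (_ * _)%E; apply: eq_eseriesr => m _; congr EFin.
  rewrite /bfun -/(acoef m) /step_coef/=; case: ifPn => _; last by rewrite !mul0r.
  (* Of the exponent [k + 2], two factors come from [dt_beta] and [k] from the letters [fcot]. *)
  rewrite natrM -[k.+2]addn2 exprD [(_ ^+ k * _)^-1]invfM.
  by move: (_ ^- 2) (_ ^- k) => p q; ring.
- rewrite hformE//; last exact: good_beta.
  apply: estep_beta => // [m|t tA]; first exact: step_coef_ge0.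
  have s0 := sg_gt0 t tA; have c0 := cg_gt0 t (half_dom t tA).
  rewrite beta_series// beta_series_shift !muleA -!EFinM; congr (_%:E * _)%E.
  by field; rewrite !lt0r_neq0.
- rewrite /esum_words big_seq1/=; apply: estep_beta => // [m|t tA].
    exact: step_coef_ge0.
  have s0 := sg_gt0 t tA.
  have nn m : 0 <= step_coef (R:=R) L2mp1 2 n m * acoef m.
    by rewrite mulr_ge0 ?step_coef_ge0// ltW// acoef_gt0.
  rewrite -/(eword _ _) eword_cot.
  rewrite (@iter_cot _ (fun m => (2 * m).+1)%N _ _ _ nn _ (csc_beta_plus n))//.
  rewrite fcscE// !scale_series; last 2 first.
  + by move=> m; rewrite mulr_ge0 ?step_coef_ge0 ?bfun_ge0.
  + by move=> m; rewrite mulr_ge0 ?divr_ge0 ?nn ?exprn_ge0// ltW.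
  apply: eq_eseriesr => m _; congr EFin.
  rewrite /bfun -/(acoef m) /step_coef/=.
  case: ifPn => _; last by rewrite !mul0r !mulr0.
  rewrite -[(2 * m).+1%:R]natr1 natrM -[k.+2]addn2 exprD.
  rewrite [(_ ^+ k * _)^-1]invfM [sg t ^+ (2 * m).+1]exprS.
  by move: (_ ^- 2) (_ ^- k) => p q; field; rewrite lt0r_neq0.
- rewrite /esum_words big_cons big_seq1 (sin_cot_beta n 0)//.
  rewrite [eword [:: ftan] _ _]ftan_beta// -sum_minus; congr (_ + _)%E.
  by apply: eq_eseriesr => m _; rewrite expr0 divr1.
- by rewrite /esum_words big_cons big_seq1 !sin_cot_beta// sum_minus.
Qed.

(** * Positivity and evaluation of the composed words *)

Variable fb : nat -> R -> R.
Hypothesis fbE : forall n t, 0 < t < A -> fb n t = rho t * bfun n (sg t).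
Hypothesis hform_pos : all_words (all_letters (pos_form A)) hform.

Lemma pos_form_eq (f g : R -> R) : (forall t, 0 < t < A -> f t = g t) ->
  (forall t, 0 < t < A -> {for t, continuous g}) ->
  (forall t, 0 < t < A -> 0 < g t) -> pos_form A f.
Proof.
move=> fg cg' g0; split; last by move=> t tA; rewrite fg// g0.
apply: eq_measurable_fun (measurable_half g cg') => t.
by rewrite inE/= in_itv/= => tA; rewrite fg.
Qed.

Lemma sg_neq0 (t : R) : 0 < t < A -> sg t != 0.
Proof. by move=> tA; rewrite lt0r_neq0// sg_gt0. Qed.

Lemma pos_fcot : pos_form A fcot.
Proof.
apply: (pos_form_eq _ (fun t => rho t * (cg t / sg t))) => // t tA.
  have t' := half_dom t tA; apply: (@continuousM _ _ rho); first exact: crho.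
  apply: (@continuousM _ _ cg); first exact: ccg.
  by apply: continuousV; [exact: sg_neq0|exact: csg].
by rewrite mulr_gt0 ?divr_gt0 ?sg_gt0 ?rho_gt0 ?cg_gt0// half_dom.
Qed.

Lemma pos_fcsc : pos_form A fcsc.
Proof.
apply: (pos_form_eq _ (fun t => rho t / sg t)) => // t tA.
  have t' := half_dom t tA; apply: (@continuousM _ _ rho); first exact: crho.
  by apply: continuousV; [exact: sg_neq0|exact: csg].
by rewrite divr_gt0 ?sg_gt0 ?rho_gt0// half_dom.
Qed.

Lemma pos_fsin : pos_form A fsin.
Proof.
apply: (pos_form_eq _ (fun t => rho t * sg t)) => // t tA.
  have t' := half_dom t tA; apply: (@continuousM _ _ rho); first exact: crho.
  exact: csg.
by rewrite mulr_gt0 ?sg_gt0 ?rho_gt0// half_dom.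
Qed.

Lemma pos_ftan : pos_form A ftan.
Proof.
apply: (pos_form_eq _ (fun t => rho t * (sg t / cg t))) => // t tA.
  have t' := half_dom t tA; apply: (@continuousM _ _ rho); first exact: crho.
  apply: (@continuousM _ _ sg); first exact: csg.
  by apply: continuousV; [rewrite lt0r_neq0// cg_gt0|exact: ccg].
by rewrite mulr_gt0 ?divr_gt0 ?sg_gt0 ?rho_gt0 ?cg_gt0// half_dom.
Qed.

Lemma pos_fb n : pos_form A (fb n).
Proof.
apply: (pos_form_eq _ (fun t => rho t * bfun n (sg t))) => [t tA|t tA|t tA].
- exact: fbE.
- by apply: cbeta_integrand; exact: half_dom.
- apply: mulr_gt0; first by rewrite rho_gt0// half_dom.
  by apply: mulr_gt0; [exact: acoef_gt0|rewrite exprn_gt0// sg_gt0].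
Qed.

Lemma gen_form_pos l s : all_words (all_letters (pos_form A)) (gen_form l s).
Proof.
have pr := pos_rho; have pc := pos_fcot; have ps := pos_fcsc.
have pi := pos_fsin; have pt := pos_ftan.
have tl k f : pos_form A f -> all_letters (pos_form A) (nseq k fcot ++ [:: f]).
  by move=> pf; apply: all_letters_cat => //; exact: all_letters_nseq.
case: l; case: s => [|[|k]]; rewrite /gen_form; do ![done|split=> //|exact: tl].
Qed.

Definition gen_words {d : nat} (l : d.-tuple lfun) (s : d.-tuple nat) (n : nat)
    : fsum R :=
  ((\big[fcomp/fone]_(j < d) gen_form (tnth l j) (tnth s j))
   ** Defs.form (fb n))%form.

Lemma gen_words0 (l : 0.-tuple lfun) (s : 0.-tuple nat) n :
  gen_words l s n = [:: [:: fb n]].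
Proof. by rewrite /gen_words big_ord0 comp1f. Qed.

Lemma gen_words_cons d l1 (l : d.-tuple lfun) s1 (s : d.-tuple nat) n :
  gen_words [tuple of l1 :: l] [tuple of s1 :: s] n
  = (gen_form l1 s1 ** gen_words l s n)%form.
Proof.
rewrite /gen_words big_ord_recl !tnth0 fcompA; congr (_ ** _ ** _)%form.
by apply: eq_bigr => j _; rewrite !tnthS.
Qed.

Lemma gen_words_pos d (l : d.-tuple lfun) (s : d.-tuple nat) n :
  all_words (all_letters (pos_form A)) (gen_words l s n).
Proof.
elim: d l s => [|d ih] l s.
  by rewrite gen_words0; split=> //; split=> //; exact: pos_fb.
case/tupleP: l => l1 l; case/tupleP: s => s1 s; rewrite gen_words_cons.
apply: (all_words_comp (all_letters (pos_form A)) (all_letters (pos_form A))) => //.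
- by move=> u w; exact: all_letters_cat.
- exact: gen_form_pos.
Qed.

Lemma gen_wordsE d (l : d.-tuple lfun) (s : d.-tuple nat) n (y : R) :
  (forall j, 0 < tnth s j)%N -> 0 < y <= A ->
  (esum_words (gen_words l s n) (fun=> 1) y
   = \sum_(m <oo) (chain_weight l s n m)%:E * beta m y)%E.
Proof.
move=> + /[dup] yA /andP[_ yA']; elim: d l s y yA yA' => [|d ih] l s y yA yA' s_gt0.
  rewrite gen_words0 [l]tuple0 [s]tuple0 chain_weight_nil; last first.
    by move=> m; rewrite beta_ge0.
  rewrite /esum_words big_seq1/=; apply: (eq_estep A) => // t tA.
  by rewrite mule1 -EFinM fbE.
case/tupleP: l => l1 l; case/tupleP: s s_gt0 => s1 s s_gt0.
rewrite gen_words_cons (esum_words_comp A)//;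
  do ?[exact: gen_form_pos|exact: gen_words_pos|exact: good_cst].
have s1_gt0 : (0 < s1)%N by have := s_gt0 ord0; rewrite tnth0.
have s'_gt0 j : (0 < tnth s j)%N by have := s_gt0 (lift ord0 j); rewrite tnthS.
transitivity (esum_words (gen_form l1 s1)
   (fun t => \sum_(k <oo) (chain_weight l s n k)%:E * beta k t)%E y).
  apply: (eq_esum_words A) => // t tA; apply: ih => //.
  by case/andP: tA.
rewrite (esum_words_scaled_series A)//;
  do ?[exact: gen_form_pos|by move=> k; exact: chain_weight_ge0|exact: good_beta].
rewrite chain_weight_cons; last by move=> m; rewrite beta_ge0.
by apply: eq_eseriesr => k _; rewrite gen_form_beta.
Qed.

(** * Parity of the composed words *)

Hypothesis sgN : forall t, sg (- t) = - sg t.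
Hypothesis rhoN : has_parity false rho.
Hypothesis fcotN : has_parity true fcot.
Hypothesis fcscN : has_parity true fcsc.
Hypothesis fsinN : has_parity true fsin.
Hypothesis ftanN : has_parity true ftan.
Hypothesis fbN : forall n, has_parity false (fb n).

(** An odd letter preserves the parity of the word that follows it and an even letter reverses it.
    The even letter [rho] occurs twice or not at all in a block, and the last letter [fb n] is even,
    so every full word is odd. *)
Definition keeps_odd (u : word R) :=
  forall w, word_parity w true -> word_parity (u ++ w) true.

Hypothesis hform_odd : all_words keeps_odd hform.

Lemma word_parity_cot k (w : word R) b : word_parity w b ->
  word_parity (nseq k fcot ++ w) b.
Proof.
by move=> wb; elim: k => //= k ih; exists true, b; split => //; case: (b).
Qed.

Lemma word_parity_cons b1 b2 (f : R -> R) w : has_parity b1 f -> word_parity w b2 ->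
  word_parity (f :: w) (~~ (b1 (+) b2)).
Proof. by move=> pf pw; exists b1, b2. Qed.

Lemma gen_form_odd l s : all_words keeps_odd (gen_form l s).
Proof.
have odd2 f g k : has_parity true f -> has_parity true g ->
    keeps_odd (f :: nseq k fcot ++ [:: g]).
  move=> pf pg w pw; rewrite cat_cons -catA.
  apply: (word_parity_cons true true) => //; apply: word_parity_cot.
  exact: (word_parity_cons true true).
have even2 k : keeps_odd (rho :: nseq k fcot ++ [:: rho]).
  move=> w pw; rewrite cat_cons -catA.
  apply: (word_parity_cons false false) => //; apply: word_parity_cot.
  exact: (word_parity_cons false true).
have odd1 : keeps_odd [:: ftan] by move=> w pw; exact: (word_parity_cons true true).
case: l; case: s => [|[|k]]; rewrite /gen_form;
  do ![done|split=> //|exact: odd2|exact: even2|exact: (odd2 _ _ 0)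
      |exact: (odd2 _ _ k.+1)].
Qed.

Lemma gen_words_odd d (l : d.-tuple lfun) (s : d.-tuple nat) n :
  all_words (word_parity ^~ true) (gen_words l s n).
Proof.
elim: d l s => [|d ih] l s.
  rewrite gen_words0; split=> //; exists false, false; split => //.
case/tupleP: l => l1 l; case/tupleP: s => s1 s; rewrite gen_words_cons.
apply: (all_words_comp keeps_odd (word_parity ^~ true)) => //.
- by move=> u w; apply.
- exact: gen_form_odd.
Qed.

(** * The iterated integral as a primitive of a continuous function *)

Definition weighted_sum (l : seq lfun) (s : seq nat) (n : nat) (x : R) : \bar R :=
  (\sum_(m <oo) (chain_weight l s n m)%:E * (bfun m x)%:E)%E.

Section Primitive.
(** [c] bounds the arguments and [w] bounds [sg] on [[-c, c]]. As [c = A] is allowed, continuity is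
    assumed anew on the closed interval. *)
Variables (d : nat) (l : d.-tuple lfun) (s : d.-tuple nat) (n : nat) (c w : R).
Hypothesis s_gt0 : forall j, (0 < tnth s j)%N.
Hypothesis c_gt0 : 0 < c.
Hypothesis cA : c <= A.
Hypothesis w_ge0 : 0 <= w.
Hypothesis crho_c : forall t, - c <= t <= c -> {for t, continuous rho}.
Hypothesis csg_c : forall t, - c <= t <= c -> {for t, continuous sg}.
Hypothesis sg_w : forall t, - c <= t <= c -> - w <= sg t <= w.
Hypothesis fin_w : (weighted_sum l s n w < +oo)%E.

Let N m : R := chain_weight l s n m.

Lemma weighted_sumE (x : R) : weighted_sum l s n x
  = (\sum_(m <oo) (N m * acoef m * x ^+ (2 * m))%:E)%E.
Proof. by apply: eq_eseriesr => m _; rewrite -EFinM mulrA. Qed.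

Lemma weighted_sum_fin (x : R) : - w <= x <= w ->
  weighted_sum l s n x \is a fin_num.
Proof.
move=> /andP[wx xw]; rewrite ge0_fin_numE; last first.
  apply: nneseries_ge0 => m _ _.
  by rewrite mule_ge0// lee_fin ?chain_weight_ge0 ?bfun_ge0.
apply: le_lt_trans fin_w; apply: lee_nneseries => m _.
  by rewrite mule_ge0// lee_fin ?chain_weight_ge0 ?bfun_ge0.
rewrite lee_wpmul2l ?lee_fin ?chain_weight_ge0//.
rewrite ler_wpM2l ?(ltW (acoef_gt0 m))// !(exprM _ 2).
by rewrite lerXn2r ?nnegrE ?sqr_ge0//; nra.
Qed.

(* Clamping at [c] makes the integrand continuous on the whole line, so that its
   primitive also has a derivative at the end points [c] and [- c]. *)
Definition clamped_integrand (t : R) : R :=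
  rho (clamp c t) * fine (weighted_sum l s n (sg (clamp c t))).

Lemma clamped_integrand_continuous : continuous clamped_integrand.
Proof.
have cc t : - c <= clamp c t <= c by apply: clamp_le; exact: ltW.
have -> : clamped_integrand = (fun t => rho (clamp c t)
    * fine (\sum_(m <oo) (N m * acoef m * clamp w (sg (clamp c t)) ^+ (2 * m))%:E)%E).
  by apply/funext => t; rewrite (clamp_id w) ?sg_w// -weighted_sumE.
move=> t; apply: (@continuousM _ _ (fun t => rho (clamp c t))).
  apply: (@continuous_comp _ _ _ (clamp c) rho); first exact: clamp_continuous.
  exact: crho_c.
apply: (@continuous_comp _ _ _ (fun t => sg (clamp c t))
  (fun x => fine (\sum_(m <oo) (N m * acoef m * clamp w x ^+ (2 * m))%:E)%E)).
  apply: (@continuous_comp _ _ _ (clamp c) sg); first exact: clamp_continuous.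
  exact: csg_c.
apply: (clamped_series_continuous (fun m => N m * acoef m)) => //.
  by move=> m; rewrite mulr_ge0 ?chain_weight_ge0// ltW// acoef_gt0.
by rewrite -weighted_sumE.
Qed.

Lemma clamped_integrandN t : clamped_integrand (- t) = clamped_integrand t.
Proof.
rewrite /clamped_integrand clampN ?ltW// rhoN expr0 mul1r sgN; congr (_ * fine _).
apply: eq_eseriesr => m _; congr (_ * _%:E)%E.
by rewrite /bfun exprM sqrrN -exprM.
Qed.

(** A continuous function has finite integral over [[0, y]]; this finiteness gives convergence of
    all the words at once. *)
Lemma gen_words_primitive_pos (y : R) : 0 < y <= c ->
  convergent (gen_words l s n) y /\
  iterint (gen_words l s n) y = integral_from0 clamped_integrand y.
Proof.
move=> /andP[y0 yc]; have yA : 0 < y <= A by rewrite y0 (le_trans yc).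
have int : mu.-integrable `]0, y[ (EFin \o clamped_integrand).
  have : mu.-integrable `[0, y] (EFin \o clamped_integrand).
    apply: continuous_compact_integrable; first exact: segment_compact.
    by apply: continuous_subspaceT; exact: clamped_integrand_continuous.
  by apply: integrableS => //; exact: subset_itv_oo_cc.
have E : (esum_words (gen_words l s n) (fun=> 1) y
    = \int[mu]_(t in `]0%R, y[) (clamped_integrand t)%:E)%E.
  have /andP[_ yA'] := yA; rewrite gen_wordsE//.
  (* Tonelli in reverse: the series of the [beta_m] is gathered under one integral. *)
  transitivity (estep rho (fun t => weighted_sum l s n (sg t)) y).
    apply: esym; apply: (estep_beta N) => // m; exact: chain_weight_ge0.
  apply: eq_integral => t; rewrite inE/= in_itv/= => /andP[t0 ty].
  have tc : - c <= t <= c.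
    rewrite (le_trans (ltW ty))// (le_trans _ (ltW t0))//.
    by rewrite oppr_le0 ltW.
  by rewrite /clamped_integrand clamp_id// EFinM fineK// weighted_sum_fin// sg_w.
have fi : (\int[mu]_(t in `]0%R, y[) (clamped_integrand t)%:E)%E \is a fin_num.
  exact: integrable_fin_num.
have [||cv eqI] := convergent_esum_words A (gen_words l s n) y _ yA.
- exact: gen_words_pos.
- by rewrite E; move: fi; rewrite fin_numElt => /andP[].
split=> //; apply: EFin_inj; rewrite eqI E /integral_from0 gtr0_sg// mul1r.
by rewrite (segment0_pos _ y0) /Rintegral fineK.
Qed.

Lemma gen_words_primitive (y : R) : - c <= y <= c ->
  convergent (gen_words l s n) y /\
  iterint (gen_words l s n) y = integral_from0 clamped_integrand y.
Proof.
move=> /andP[cy yc]; have [y0|y0|->] := ltgtP y 0; last first.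
- split; first exact: convergent0.
  rewrite integral_from00 iterint0//.
  apply: (all_words_impl (word_parity ^~ true)); first exact: word_parity_neq0.
  exact: gen_words_odd.
- by apply: gen_words_primitive_pos; rewrite y0.
have ny0 : 0 < - y by rewrite oppr_gt0.
have [|cv eqI] := gen_words_primitive_pos (- y); first by rewrite ny0 lerNl.
have [cv' eqI'] := fsum_reflect _ _ ny0 (gen_words_odd _ l s n) cv.
rewrite opprK in cv' eqI'; split => //.
rewrite eqI' eqI.
have int : mu.-integrable (segment0 (- y)) (fun t => (clamped_integrand t)%:E).
  rewrite (segment0_pos _ ny0).
  have : mu.-integrable `[0, - y] (EFin \o clamped_integrand).
    apply: continuous_compact_integrable; first exact: segment_compact.
    by apply: continuous_subspaceT; exact: clamped_integrand_continuous.
  by apply: integrableS => //; exact: subset_itv_oo_cc.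
have [|_] := integral_from0_reflect _ false (- y) ny0 _ int.
  by move=> t _; rewrite clamped_integrandN expr0 mul1r.
by rewrite opprK expr1 mulN1r => ->.
Qed.

End Primitive.

End CircleParametrization.

(** * The trigonometric and algebraic parametrizations *)

Section Instances.
Context {R : realType}.

Lemma weighted_sum_lty_lt1 (l : seq lfun) (s : seq nat) n (w : R) :
  size l = size s -> all (fun k => 0 < k)%N s -> 0 <= w < 1 ->
  (weighted_sum l s n w < +oo)%E.
Proof.
move=> sz s0 /bfun_le_vcoef[K hK].
apply: (chain_weight_vcoef_lty _ _ _ _ K) => // m.
by rewrite !lee_fin hK bfun_ge0.
Qed.

Lemma weighted_sum_lty1 (l : seq lfun) (s : seq nat) n :
  size l = size s -> all (fun k => 0 < k)%N s -> (1 < head 0 s)%N ->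
  (weighted_sum l s n (1 : R) < +oo)%E.
Proof.
case: l => [|l1 l]; case: s => [|s1 s] //= [sz] /andP[_ s0] s1_gt1.
have := chain_weight_acoef_lty (R:=R) l1 l s1 s n s1_gt1 sz s0.
congr (_ < _)%E; apply: eq_eseriesr => m _.
by rewrite /bfun expr1n mulr1.
Qed.

(** The comparison function [G] has a two-sided derivative, and restricting its difference quotient
    to [D] covers end points too. *)
Lemma has_derivative_on_eq (D : set R) (F G : R -> R) (y v : R) :
  is_derive y 1 G v -> F y = G y -> (\forall z \near y, D z -> F z = G z) ->
  has_derivative_on D F y v.
Proof.
move=> dG Fy FG; rewrite /has_derivative_on.
have shift : (fun z => z - y) @ within (D `\ y) (nbhs y) --> 0^'.
  move=> P; rewrite /dnbhs => hP.
  have c0 : (fun z => z - y) @ y --> y - y.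
    by apply: cvgB; [exact: cvg_id|exact: cvg_cst].
  rewrite subrr in c0; change (nbhs y [set z | (D `\ y) z -> P (z - y)]).
  have : nbhs y [set z | z - y != 0 -> P (z - y)] by exact: c0 hP.
  apply: filterS => z hz [_ zy].
  by apply: hz; rewrite subr_eq0; exact/eqP.
have [dv <-] := dG.
apply: (@cvg_trans _ ((fun h => h^-1 *: (G (h *: 1 + y) - G y)) \o
    (fun z => z - y) @ within (D `\ y) (nbhs y))).
  apply: near_eq_cvg; rewrite near_withinE.
  apply: filterS FG => z FGz [Dz _] /=.
  rewrite Fy FGz// /GRing.scale/= mulr1 subrK mulrC//.
by apply: cvg_comp shift _; exact: dv.
Qed.

Lemma lambda_gen l s : lambda l s
  = gen_form (fun=> 1) cot csc sin tan (Defs.form (fun t : R => 2 * csc (2 * t))) l s.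
Proof. by case: l; case: s => [|[|k]] //=; rewrite /cot_dt fpow_form. Qed.

Lemma trig_integrand_gen d (l : d.-tuple lfun) (s : d.-tuple nat) n :
  trig_integrand l s n
  = gen_words (fun=> 1) cot csc sin tan (Defs.form (fun t : R => 2 * csc (2 * t)))
      (fun n t => bfun n (sin t)) l s n.
Proof.
rewrite /trig_integrand /gen_words; congr (_ ** _)%form.
by apply: eq_bigr => j _; rewrite lambda_gen.
Qed.

Lemma csc_double (t : R) : 2 * csc (2 * t) = 1 / (sin t * cos t).
Proof.
rewrite /csc; have -> : sin (2 * t) = 2 * (sin t * cos t).
  by rewrite mulr_natl sin_mulr2n [cos t * _]mulrC mulr_natl.
by rewrite [(2 * _)^-1]invfM mulVKf ?pnatr_eq0// mul1r.
Qed.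

Lemma pihalf_gt0 : 0 < pi / 2 :> R.
Proof. by have /andP[] := pihalf_02 R. Qed.

Lemma trig_primitive d (l : d.-tuple lfun) (s : d.-tuple nat) n (c w y : R) :
  (forall j, 0 < tnth s j)%N -> 0 < c -> c <= pi / 2 -> 0 <= w ->
  (forall t, - c <= t <= c -> - w <= sin t <= w) ->
  (weighted_sum l s n w < +oo)%E -> - c <= y <= c ->
  convergent (trig_integrand l s n) y /\
  iterint (trig_integrand l s n) y
    = integral_from0 (clamped_integrand sin (fun=> 1) d l s n c) y.
Proof.
move=> s_gt0 c0 cA w0 sw fin yc; rewrite trig_integrand_gen.
have sgt (t : R) : 0 < t < pi / 2 -> 0 < sin t by exact: sin_gt0_pihalf.
have cgt (t : R) : - (pi / 2) < t < pi / 2 -> 0 < cos t by exact: cos_gt0_pihalf.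
apply: (@gen_words_primitive R (pi / 2) sin cos (fun=> 1) pihalf_gt0
  _ _ _ _ _ _ sgt cgt _ _ _ _ _ _ _ _ _ _ _ _ _ _ _ _ _ _ _ _ _ _ d l s n c w) => //.
- by move=> t _; rewrite mulr1; exact: is_derive_sin.
- by move=> t _; rewrite mulr1; exact: is_derive_cos.
- by move=> t _; exact: cvg_cst.
- by move=> t _; rewrite addrC cos2Dsin2.
- exact: sin0.
- by rewrite sin_pihalf.
- by move=> t _; rewrite mul1r.
- by move=> t _; rewrite mul1r.
- by move=> t _; rewrite mul1r.
- by move=> t _; rewrite mul1r.
- move=> phi u _ _; rewrite /esum_words big_seq1 /=.
  by congr estep; apply/funext => t; exact: csc_double.
- by move=> m t _; rewrite mul1r.
- split=> //; split=> //; apply: (pos_form_eq _ _ (fun t => 1 / (sin t * cos t))).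
  + by move=> t _; exact: csc_double.
  + move=> t tA; apply: (@continuousM _ _ (cst 1)); first exact: cvg_cst.
    apply: continuousV.
      by rewrite lt0r_neq0// mulr_gt0 ?sgt// cgt// (half_dom _ pihalf_gt0).
    by apply: continuousM; [exact: continuous_sin|exact: continuous_cos].
  + by move=> t tA; rewrite divr_gt0// mulr_gt0 ?sgt// cgt// (half_dom _ pihalf_gt0).
- exact: sinN.
- by move=> t; rewrite expr0 mul1r.
- by move=> t; rewrite /cot sinN cosN invrN mulrN expr1 mulN1r.
- by move=> t; rewrite /csc sinN invrN expr1 mulN1r.
- by move=> t; rewrite sinN expr1 mulN1r.
- by move=> t; rewrite tanN expr1 mulN1r.
- by move=> m t; rewrite sinN /bfun exprM sqrrN -exprM expr0 mul1r.
- split=> // u pu; apply: (word_parity_cons true true) => // t.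
  by rewrite /csc mulrN sinN invrN mulrN expr1 mulN1r.
- by move=> t _; exact: cvg_cst.
- by move=> t _; exact: continuous_sin.
Qed.

Lemma Lambda_gen l s : Lambda l s
  = gen_form omega1 omega0 omega3 omega5 omega2
      (Defs.form omega0 + Defs.form (@omega2 R))%form l s.
Proof. by case: l; case: s => [|[|k]] //=; rewrite fpow_form. Qed.

Lemma alg_integrand_gen d (l : d.-tuple lfun) (s : d.-tuple nat) n :
  alg_integrand l s n
  = gen_words omega1 omega0 omega3 omega5 omega2
      (Defs.form omega0 + Defs.form (@omega2 R))%form
      (fun n t => bfun n t * omega1 t) l s n.
Proof.
rewrite /alg_integrand /gen_words; congr (_ ** _)%form.
by apply: eq_bigr => j _; rewrite Lambda_gen.
Qed.

Lemma sqrt_circle (t : R) : -1 < t < 1 ->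
  0 < Num.sqrt (1 - t ^+ 2) /\ 1 - t ^+ 2 = Num.sqrt (1 - t ^+ 2) ^+ 2.
Proof.
move=> t1; have p : 0 < 1 - t ^+ 2 by nra.
by rewrite sqrtr_gt0 sqr_sqrtr// ltW.
Qed.

Lemma is_derive_sqrt_circle (t : R) : -1 < t < 1 ->
  is_derive t 1 (fun t : R => Num.sqrt (1 - t ^+ 2)) (- (t * omega1 t)).
Proof.
move=> t1; have [r0 _] := sqrt_circle t t1.
have p : 0 < 1 - t ^+ 2 by rewrite -sqrtr_gt0.
have dg : is_derive t 1 (fun t : R => 1 - t ^+ 2) (- (2 * t)).
  rewrite (_ : (fun x : R => 1 - x ^+ 2) = cst 1 - id ^+ 2); last first.
    by apply/funext => x; rewrite !fctE.
  apply: (is_derive_eq (is_deriveB (is_derive_cst (1 : R) t 1)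
    (is_deriveX 2 (is_derive_id t 1)))).
  by rewrite /GRing.scale/= sub0r expr1 mulr1.
have dc := @is_derive1_comp R Num.sqrt (fun t : R => 1 - t ^+ 2) t _ _
  (is_derive1_sqrt p) dg.
apply: (is_derive_eq dc).
by rewrite /omega1; field; rewrite lt0r_neq0.
Qed.

Lemma omega1_continuous (t : R) : -1 < t < 1 -> {for t, continuous (@omega1 R)}.
Proof.
move=> t1; have [r0 _] := sqrt_circle t t1.
apply: (@continuousV _ _ (fun t : R => Num.sqrt (1 - t ^+ 2))).
  by rewrite lt0r_neq0.
exact: (is_derive_continuous _ _ _ (is_derive_sqrt_circle t t1)).
Qed.

Lemma estep_formD (A : R) f g phi (y : R) : pos_form A f -> pos_form A g ->
  good A phi -> y <= A ->
  (estep (fun t => f t + g t)%R phi y = estep f phi y + estep g phi y)%E.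
Proof.
move=> pf pg gphi yA; have [m1 p1] := good_integrand _ _ _ _ pf gphi yA.
have [m2 p2] := good_integrand _ _ _ _ pg gphi yA.
rewrite /estep -ge0_integralD//; apply: eq_integral => t.
rewrite inE => /(sub_itv0 _ _ yA)/=; rewrite in_itv/= => tA.
case: pf => _ /(_ t tA) f0; case: pg => _ /(_ t tA) g0.
by rewrite EFinD ge0_muleDl// lee_fin ltW.
Qed.

Lemma alg_primitive d (l : d.-tuple lfun) (s : d.-tuple nat) n (c y : R) :
  (forall j, 0 < tnth s j)%N -> 0 < c -> c < 1 ->
  (weighted_sum l s n c < +oo)%E -> - c <= y <= c ->
  convergent (alg_integrand l s n) y /\
  iterint (alg_integrand l s n) y
    = integral_from0 (clamped_integrand id omega1 d l s n c) y.
Proof.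
move=> s_gt0 c0 c1 fin yc; rewrite alg_integrand_gen.
have dom (t : R) : 0 < t < 1 -> -1 < t < 1 by exact: (half_dom _ ltr01).
have cdom (t : R) : - c <= t <= c -> -1 < t < 1 by move=> ?; lra.
have rgt (t : R) : -1 < t < 1 -> 0 < omega1 t.
  by move=> /sqrt_circle[r0 _]; rewrite invr_gt0.
have o0 (t : R) : 0 < t < 1 ->
    omega0 t = omega1 t * (Num.sqrt (1 - t ^+ 2) / t).
  move=> /[dup] /andP[t0 _] /dom/sqrt_circle[r0 _].
  by rewrite /omega0 /omega1; field; rewrite !lt0r_neq0.
have o2 (t : R) : 0 < t < 1 ->
    omega2 t = omega1 t * (t / Num.sqrt (1 - t ^+ 2)).
  move=> /[dup] /andP[t0 _] /dom/sqrt_circle[r0 r2].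
  by rewrite /omega2 {1}r2 /omega1; field; rewrite !lt0r_neq0.
have pos0 : pos_form 1 (@omega0 R).
  apply: (pos_form_eq _ _ (@omega0 R)) => // t /andP[t0 _].
    by apply: inv_continuous; rewrite lt0r_neq0.
  by rewrite invr_gt0.
have pos2 : pos_form 1 (@omega2 R).
  apply: (pos_form_eq _ _ (fun t : R => omega1 t * (t * omega1 t))) => t t1.
  - exact: o2.
  - have ct := omega1_continuous t (dom t t1).
    apply: (@continuousM _ _ omega1) => //.
    by apply: (@continuousM _ _ id) => //; exact: cvg_id.
  - by have /andP[t0 _] := t1; rewrite !mulr_gt0 ?rgt ?dom.
apply: (@gen_words_primitive R 1 id (fun t : R => Num.sqrt (1 - t ^+ 2)) omega1 ltr01
  _ _ _ _ _ _ _ _ rgt _ _ _ _ _ _ _ _ _ _ _ _ _ _ _ _ _ _ _ _ _ d l s n c c) => //.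
- move=> t /sqrt_circle[r0 _].
  by apply: (is_derive_eq (is_derive_id t 1)); rewrite /omega1 divff// lt0r_neq0.
- exact: is_derive_sqrt_circle.
- exact: omega1_continuous.
- by move=> t /sqrt_circle[_ <-]; rewrite addrC subrK.
- by move=> t /andP[].
- by move=> t /sqrt_circle[].
- by move=> t _; rewrite /omega3 /omega1 invfM mulrC.
- by move=> t _; rewrite /omega5 /omega1 mulrC.
- move=> phi u gphi /andP[_ u1].
  rewrite /esum_words big_cons big_seq1 /= -(estep_formD 1)//.
  apply: (eq_estep 1) => // t t1; congr (_%:E * _)%E.
  have /andP[t0 _] := t1; have [r0 r2] := sqrt_circle t (dom t t1).
  rewrite o0// o2// -mulrDr; congr (_ * _).
  set r := Num.sqrt _ in r0 r2 *.
  (* After removal of [omega1], this is [1/t + t/(1-t^2) = 1/(t(1-t^2))], the counterpart of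
     [2 csc 2t = 1/(sin t cos t)]. *)
  have -> : r / t + t / r = (r ^+ 2 + t ^+ 2) / (t * r).
    by field; rewrite !lt0r_neq0.
  by rewrite -r2 subrK div1r.
- by move=> m t _; rewrite mulrC.
- by move=> t; rewrite /omega1 sqrrN expr0 mul1r.
- by move=> t; rewrite /omega0 invrN expr1 mulN1r.
- by move=> t; rewrite /omega3 sqrrN mulNr invrN expr1 mulN1r.
- by move=> t; rewrite /omega5 sqrrN mulNr expr1 mulN1r.
- by move=> t; rewrite /omega2 sqrrN mulNr expr1 mulN1r.
- by move=> m t; rewrite /omega1 /bfun exprM sqrrN -exprM expr0 mul1r.
- split; [|split=> //] => u pu; apply: (word_parity_cons true true) => // t.
    by rewrite /omega0 invrN expr1 mulN1r.
  by rewrite /omega2 sqrrN mulNr expr1 mulN1r.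
- exact: ltW.
- exact: ltW.
- by move=> t /cdom/omega1_continuous.
- by move=> t _; exact: cvg_id.
Qed.

End Instances.

Theorem theorem4p1 (R : realType) (d n : nat) (s : d.-tuple nat)
    (l : d.-tuple lfun) (d_gt0 : (0 < d)%N)
    (s_gt0 : forall j : 'I_d, (0 < tnth s j)%N) :
  (forall y : R, ydomain (head 0%N s) y ->
     convergent (trig_integrand l s n) y /\
     exists v : R,
       has_derivative_on (ydomain (head 0%N s))
         (iterint (trig_integrand l s n)) y v /\
       nested_sum l s n (sin y) = v%:E) /\
  (forall x : R, -1 < x < 1 ->
     convergent (alg_integrand l s n) x /\
     exists v : R,
       is_derive x 1 (iterint (alg_integrand l s n)) v /\
       nested_sum l s n x = (Num.sqrt (1 - x ^+ 2) * v)%:E).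
Proof.
have sz : size l = size s by rewrite !size_tuple.
have sall : all (fun k => 0 < k)%N s.
  by apply/allP => k /tnthP[j ->].
have mid (a b : R) : `|a| < b -> exists2 c, 0 < c < b & - c < a < c.
  move=> ab; exists ((`|a| + b) / 2); have := normr_ge0 a; first by lra.
  by rewrite -ltr_norml; lra.
split=> [y Dy|x x1].
  (* The cases [s_1 = 1] and [s_1 >= 2] differ only in the clamping bound [c] and the dominating
     value [w]. *)
  have trig (c w : R) : 0 < c -> c <= pi / 2 -> 0 <= w ->
      (forall t, - c <= t <= c -> - w <= sin t <= w) ->
      (weighted_sum l s n w < +oo)%E -> - c <= y <= c ->
      (\forall z \near y, ydomain (head 0%N s) z -> - c <= z <= c) ->
      convergent (trig_integrand l s n) y /\
      exists v : R,
        has_derivative_on (ydomain (head 0%N s))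
          (iterint (trig_integrand l s n)) y v /\
        nested_sum l s n (sin y) = v%:E.
    move=> c0 cA w0 sw fin yc near_c.
    have P z := trig_primitive d l s n c w z s_gt0 c0 cA w0 sw fin.
    split; first by have [] := P y yc.
    exists (clamped_integrand sin (fun=> 1) d l s n c y); split.
      apply: (@has_derivative_on_eq _ _ _
        (integral_from0 (clamped_integrand sin (fun=> 1) d l s n c))).
      - apply: is_derive_integral_from0.
        apply: (clamped_integrand_continuous _ _ _ _ _ _ _ w) => // t _.
          exact: cvg_cst.
        exact: continuous_sin.
      - by have [_] := P y yc.
      - by apply: filterS near_c => z h /h/P[].
    rewrite nested_sumE// /clamped_integrand clamp_id// mul1r fineK//.
    by apply: (weighted_sum_fin _ _ _ _ w) => //; exact: sw.
  have [s1|s1] := eqVneq (head 0%N s) 1%N.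
    have yA : `|y| < pi / 2 by rewrite ltr_norml; move: Dy; rewrite /ydomain s1.
    have [c /andP[c0 cA] yc] := mid y (pi / 2) yA.
    have cI : c \in `[- (pi / 2), pi / 2] by rewrite in_itv/=; lra.
    (* Since [c < pi / 2], the dominating value [sin c] is below 1, where the sum is finite for all
       positive exponents. *)
    apply: (trig c (sin c)) => //.
    - exact: ltW.
    - by rewrite ltW// sin_gt0_pihalf// c0.
    - move=> t tc; have tI : t \in `[- (pi / 2), pi / 2] by rewrite in_itv/=; lra.
      have ncI : - c \in `[- (pi / 2), pi / 2] by rewrite in_itv/=; lra.
      rewrite -sinN !leNgt !ltr_sin// -!leNgt//.
    - apply: weighted_sum_lty_lt1 => //.
      rewrite ltW ?sin_gt0_pihalf ?c0//=.
      have := cos2Dsin2 c; have : 0 < cos c by apply: cos_gt0_pihalf; lra.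
      nra.
    - by lra.
    - have [cy yc'] := andP yc.
      near=> z; move=> _; rewrite !ltW//; near: z.
        exact: lt_nbhsl.
      exact: lt_nbhsr.
  have s1_gt1 : (1 < head 0 s)%N.
    have h0 : (0 < head 0 s)%N.
      have : (0 < size s)%N by rewrite size_tuple.
      by case: (tval s) sall => //= s1' s' /andP[].
    by case: (head 0%N s) h0 s1 => [|[|]].
  have Dc (z : R) : ydomain (head 0%N s) z -> - (pi / 2) <= z <= pi / 2.
    by rewrite /ydomain/= (negbTE s1).
  (* Clamping at the end points themselves; finiteness at [w = 1] is where [s_1 >= 2] enters. *)
  apply: (trig (pi / 2) 1) => //.
  - exact: pihalf_gt0.
  - by move=> t _; rewrite sin_geN1 sin_le1.
  - exact: weighted_sum_lty1.
  - exact: Dc.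
  - by near=> z; exact: Dc.
have [c /andP[c0 c1] xc] : exists2 c, 0 < c < 1 & - c < x < c.
  by apply: mid; rewrite ltr_norml.
have fin : (weighted_sum l s n c < +oo)%E.
  by apply: weighted_sum_lty_lt1 => //; rewrite c1 ltW.
have P z := alg_primitive d l s n c z s_gt0 c0 c1 fin.
have xc' : - c <= x <= c by lra.
split; first by have [] := P x xc'.
exists (clamped_integrand id omega1 d l s n c x); split.
  apply: (@near_eq_is_derive _ _ _
     (integral_from0 (clamped_integrand id omega1 d l s n c))).
    have [cx xc2] := andP xc.
    near=> z; apply/esym; have [] // := P z.
    apply/andP; split; apply: ltW; near: z; [exact: lt_nbhsr|exact: lt_nbhsl].
  apply: is_derive_integral_from0.
  apply: (clamped_integrand_continuous _ _ _ _ _ _ _ c) => // [|t tc|t _].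
  - exact: ltW.
  - by apply: omega1_continuous; lra.
  - exact: cvg_id.
rewrite nested_sumE// /clamped_integrand clamp_id//.
have [r0 _] := sqrt_circle x x1.
rewrite /omega1 mulVKf ?lt0r_neq0// fineK//.
exact: (weighted_sum_fin _ _ _ _ c).
Unshelve. all: by end_near. Qed.
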